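(* Let $0<\gamma<\alpha<1$. Then there exist positive constants $A$ and $B$, depending only on $n,p,\gamma,\alpha$, such that, for any $f\in\mathrm{BMO}^+(\gamma)$, $R\in\mathcal{R}$, and $\lambda\in(0,\infty)$, $$\left|R^-(\alpha)\cap\left\{f-f_{R^+(\gamma)}>\lambda\right\}\right|\leq A\,e^{-\frac{B\lambda}{\|f\|_{\mathrm{BMO}^+(\gamma)}}}\left|R^-(\alpha)\right|.$$
   Context: Work in $\mathbb{R}^{n+1}$, with points $(x,t)$, $x\in\mathbb{R}^n$, $t\in\mathbb{R}$; $p\in(1,\infty)$ is fixed throughout. $Q(x,L)=\{y\in\mathbb{R}^n: x_i-\frac L2\le y_i<x_i+\frac L2 \text{ for all } i\in\{1,\dots,n\}\}$. A parabolic rectangle centered at $(x,t)$ with edge length $L\in(0,\infty)$ is $R=R(x,t,L)=Q(x,L)\times[t-L^p,t+L^p)$; $\mathcal{R}$ is the set of all parabolic rectangles. For $\gamma\in[0,1)$, $R^-(\gamma)=Q(x,L)\times[t-L^p,t-\gamma L^p)$ and $R^+(\gamma)=Q(x,L)\times[t+\gamma L^p,t+L^p)$. $|A|$ is Lebesgue measure, $f_A=\fint_A f=\frac1{|A|}\int_A f$, $f_+=\max\{f,0\}$. $\mathrm{BMO}^+(\gamma)$ is the set of all locally integrable real-valued functions $f$ on $\mathbb{R}^{n+1}$ with $$\|f\|_{\mathrm{BMO}^+(\gamma)}=\sup_{R\in\mathcal{R}}\fint_{R^-(\gamma)}[f-f_{R^+(\gamma)}]_+<\infty.$$ If $\|f\|_{\mathrm{BMO}^+(\gamma)}=0$,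 the exponential $e^{-B\lambda/\|f\|_{\mathrm{BMO}^+(\gamma)}}$ is read as $0$. *)

(* Defs.v *)
From HB Require Import structures.
From mathcomp Require Import all_boot all_order all_algebra.
From mathcomp Require Import all_classical all_reals all_analysis.
Set Implicit Arguments.
Unset Strict Implicit.
Unset Printing Implicit Defensive.
Import Order.TTheory GRing.Theory Num.Theory.
Import numFieldNormedType.Exports.
Local Open Scope classical_set_scope.
Local Open Scope ring_scope.

Section rV_measurable.
Context {R : realType} {n : nat}.

Let coors : 'I_n -> 'rV[R]_n -> measurableTypeR R := fun i x => x ord0 i.

Let rV_set0 : g_sigma_preimage coors set0.
Proof. exact: sigma_algebra0. Qed.

Let rV_setC A : g_sigma_preimage coors A -> g_sigma_preimage coors (~` A).
Proof. exact: sigma_algebraC. Qed.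

Let rV_bigcup (F : (set 'rV[R]_n)^nat) : (forall i, g_sigma_preimage coors (F i)) ->
  g_sigma_preimage coors (\bigcup_i (F i)).
Proof. exact: sigma_algebra_bigcup. Qed.

(* The same sigma-algebra as the one the library puts on n.-tuple R: the one
   generated by the coordinates, i.e. the Borel sigma-algebra of R^n. *)
HB.instance Definition _ := @isMeasurable.Build default_measure_display
  'rV[R]_n (g_sigma_preimage coors) rV_set0 rV_setC rV_bigcup.

End rV_measurable.

Section rV_measurable_fun.
Context {R : realType}.

Lemma measurable_rV_coord n (i : 'I_n) :
  measurable_fun [set: 'rV[R]_n]
    (fun x : 'rV[R]_n => x ord0 i : measurableTypeR R).
Proof.
move=> _ Y mY; rewrite setTI; apply: sub_sigma_algebra => /=.
rewrite -bigcup_seq/=; exists i => /=; first by rewrite mem_index_enum.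
by exists Y => //; rewrite setTI.
Qed.

Lemma measurable_fun_rVP d (T : measurableType d) n (f : T -> 'rV[R]_n) :
  (forall i, measurable_fun [set: T]
    (fun x => f x ord0 i : measurableTypeR R)) ->
  measurable_fun [set: T] f.
Proof.
move=> mf _ A mA; rewrite setTI; move: A mA.
apply: smallest_sub.
  split => /=.
  - by rewrite preimage_set0.
  - by move=> A mA; rewrite setTD preimage_setC; exact: measurableC.
  - by move=> F mF; rewrite preimage_bigcup; exact: bigcup_measurable.
rewrite -bigcup_seq => A [i _] [B mB <-]; rewrite setTI.
by have := mf i measurableT B mB; rewrite setTI.
Qed.

Definition rV_cons n (z : measurableTypeR R * 'rV[R]_n) : 'rV[R]_n.+1 :=
  row_mx (const_mx z.1 : 'rV[R]_1) z.2.

Definition rV_uncons n (y : 'rV[R]_n.+1) : measurableTypeR R * 'rV[R]_n :=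
  (y ord0 ord0, \row_i y ord0 (lift ord0 i)).

Lemma rV_consK n : cancel (@rV_cons n) (@rV_uncons n).
Proof.
move=> [a x]; rewrite /rV_uncons /rV_cons; congr pair.
  by rewrite mxE; case: splitP => // j; rewrite mxE.
by apply/rowP => i; rewrite !mxE; case: splitP => /= [[[]]//|j []/= /val_inj->].
Qed.

Lemma measurable_rV_cons n : measurable_fun setT (@rV_cons n).
Proof.
apply: measurable_fun_rVP => i.
case: (unliftP ord0 i) => [j|] ->.
  rewrite (_ : (fun _ => _) = (fun x : 'rV[R]_n => x ord0 j) \o snd); last first.
    apply/funext => z /=; rewrite -[z in LHS]/(z).
    by rewrite -{2}(rV_consK z) /rV_uncons /= mxE.
  exact: measurableT_comp (measurable_rV_coord j) measurable_snd.
rewrite (_ : (fun _ => _) = fst); first exact: measurable_fst.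
by apply/funext => z; rewrite -{2}(rV_consK z).
Qed.

Lemma measurable_rV_uncons n : measurable_fun setT (@rV_uncons n).
Proof.
apply/measurable_fun_pairP; split; first exact: (measurable_rV_coord ord0).
apply: measurable_fun_rVP => i.
rewrite (_ : (fun _ => _) = fun y : 'rV[R]_n.+1 => y ord0 (lift ord0 i)).
  exact: measurable_rV_coord.
by apply/funext => y; rewrite /= mxE.
Qed.

End rV_measurable_fun.

Section lebesgue_rV_step.
Context {R : realType} {n : nat}.
Variable m : {sigma_finite_measure set 'rV[R]_n -> \bar R}.
Local Open Scope ereal_scope.

Definition lebesgue_rV_step : set 'rV[R]_n.+1 -> \bar R :=
  pushforward (@lebesgue_measure R \x m) (@rV_cons R n).

Let step0 : lebesgue_rV_step set0 = 0.
Proof. by rewrite /lebesgue_rV_step /pushforward preimage_set0 measure0. Qed.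

Let step_ge0 A : 0 <= lebesgue_rV_step A.
Proof. by rewrite /lebesgue_rV_step /pushforward; exact: measure_ge0. Qed.

Let step_sigma_additive : semi_sigma_additive lebesgue_rV_step.
Proof.
move=> F mF tF mUF; rewrite /lebesgue_rV_step /pushforward preimage_bigcup.
apply: measure_semi_sigma_additive.
- by move=> k; rewrite -[X in measurable X]setTI; exact: measurable_rV_cons.
- apply/trivIsetP => /= i j _ _ ij; rewrite -preimage_setI.
  by move/trivIsetP : tF => /(_ _ _ _ _ ij) ->//; rewrite preimage_set0.
- rewrite -preimage_bigcup -[X in measurable X]setTI.
  exact: measurable_rV_cons.
Qed.

HB.instance Definition _ := isMeasure.Build _ _ _ lebesgue_rV_step
  step0 step_ge0 step_sigma_additive.

(* The library's sigma-finite instance for \x is shadowed by the one for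
   subprobabilities, so sigma-finiteness of the product is reproved here. *)
Let product_sigma_finite : sigma_finite setT (@lebesgue_measure R \x m).
Proof.
have /sigma_finiteP[F [TF ndF Foo]] := sigma_finiteT (@lebesgue_measure R).
have /sigma_finiteP[G [TG ndG Goo]] := sigma_finiteT m.
exists (fun k => F k `*` G k).
  rewrite -setXTT TF TG predeqE => -[x y]; split.
    move=> [/= [i _ Fix] [k _ Gky]]; exists (maxn i k) => //; split.
    - by move: x Fix; exact/subsetPset/ndF/leq_maxl.
    - by move: y Gky; exact/subsetPset/ndG/leq_maxr.
  by move=> [k _ []/= ? ?]; split; exists k.
move=> k; have [? ?] := Foo k; have [? ?] := Goo k.
split; first exact: measurableX.
by rewrite product_measure1E// lte_mul_pinfty// ge0_fin_numE.
Qed.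

Let step_sigma_finite : sigma_finite setT lebesgue_rV_step.
Proof.
have [F TF mF] := product_sigma_finite.
exists (fun k => @rV_uncons R n @^-1` F k).
  by rewrite -preimage_bigcup -TF preimage_setT.
move=> k; have [mFk Foo] := mF k; split.
  by rewrite -[X in measurable X]setTI; exact: measurable_rV_uncons.
rewrite /lebesgue_rV_step /pushforward -comp_preimage.
rewrite (_ : _ \o _ = id) ?preimage_id//.
by apply/funext => z; exact: rV_consK.
Qed.

HB.instance Definition _ := Measure_isSigmaFinite.Build _ _ _
  lebesgue_rV_step step_sigma_finite.

End lebesgue_rV_step.

(* Lebesgue measure on the Borel sets of R^n, as an iterated product of
   one-dimensional Lebesgue measures. *)
Fixpoint lebesgue_rV {R : realType} (n : nat) :
    {sigma_finite_measure set 'rV[R]_n -> \bar R} :=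
  match n with
  | 0 => dirac (0 : 'rV[R]_0)
  | k.+1 => lebesgue_rV_step (lebesgue_rV k)
  end.

Section spacetime.
Context (R : realType) (n : nat).

Definition borel_lebesgue :
    {measure set ('rV[R]_n * measurableTypeR R) -> \bar R} :=
  (lebesgue_rV n \x @lebesgue_measure R)%E.

(* R^n x R with the sigma-algebra of Lebesgue measurable sets, that is, the
   completion of the Borel one. *)
Definition spacetime : measurableType _ :=
  caratheodory_type (borel_lebesgue^*)%mu.

Definition lebesgue : {measure set spacetime -> \bar R} :=
  @completed_measure_extension _ _ _ borel_lebesgue.

Definition locally_integrable_spacetime (f : spacetime -> R) :=
  measurable_fun setT f /\
  forall K : set ('rV[R]_n * R), compact K ->
    lebesgue.-integrable (K : set spacetime) (EFin \o f).

(* Averages are only taken over sets of finite positive measure. *)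
Definition eaverage (A : set spacetime) (g : spacetime -> \bar R) : \bar R :=
  ((fine (lebesgue A))^-1%:E * \int[lebesgue]_(z in A) g z)%E.

Definition average (A : set spacetime) (f : spacetime -> R) : R :=
  fine (eaverage A (EFin \o f)).

Definition cube (x : 'rV[R]_n) (L : R) : set 'rV[R]_n :=
  [set y | forall i, x ord0 i - L / 2 <= y ord0 i < x ord0 i + L / 2].

Record parabolic_rectangle := ParabolicRectangle {
  rect_center : 'rV[R]_n;
  rect_time : R;
  rect_edge : R;
  rect_edge_gt0 : 0 < rect_edge }.

Variable p : R.

Definition rect_lower (gamma : R) (Q : parabolic_rectangle) : set spacetime :=
  cube (rect_center Q) (rect_edge Q) `*`
  `[rect_time Q - rect_edge Q `^ p, rect_time Q - gamma * rect_edge Q `^ p[.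

Definition rect_upper (gamma : R) (Q : parabolic_rectangle) : set spacetime :=
  cube (rect_center Q) (rect_edge Q) `*`
  `[rect_time Q + gamma * rect_edge Q `^ p, rect_time Q + rect_edge Q `^ p[.

Definition bmo_plus_norm (gamma : R) (f : spacetime -> R) : \bar R :=
  ereal_sup (range (fun Q : parabolic_rectangle =>
    eaverage (rect_lower gamma Q)
      (fun z => (Num.max (f z - average (rect_upper gamma Q) f) 0)%:E))).

Definition bmo_plus (gamma : R) : set (spacetime -> R) :=
  [set f | locally_integrable_spacetime f /\ (bmo_plus_norm gamma f < +oo)%E].

End spacetime.

(* The convention exp(- s / 0) = 0 is needed because division by 0 is 0 here. *)
Definition exp_decay (R : realType) (s : R) (N : \bar R) : R :=
  if N == 0%E then 0 else expR (- s / fine N).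

(* Main.v *)
(** Let [N] be the norm of [f]. One step of a good-lambda argument: raising the
    level by a fixed multiple of [N] halves the largest possible proportion of
    [R^-(alpha)] on which [f - f_{R^+(gamma)}] exceeds it. Iterating this step
    gives the exponential decay.

    For the step, [R^-(alpha)] is cut into parabolic dyadic cells. Each cell [c] lies
    in [S^-(alpha)] for a parabolic rectangle [S] of comparable size. As
    [gamma < alpha], there is room to take the scale ratio of consecutive
    generations so large that [S^+(gamma)] lies in the lower part of the rectangle
    of any ancestor. A cell is stopped when it is maximal with
    [f_{S^+(gamma)} > f_{R^+(gamma)} + K N].
    - A Vitali selection bounds the measure of the stopped cells by a quarter of
      [R^-(alpha)], because the sets [S^+(gamma)] lie in [R^-(gamma)].
    - On a stopped cell, [f_{S^+(gamma)}] exceeds [f_{R^+(gamma)}] by at most a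
      multiple of [N], through the parent cell; so the bound for [S] applies.
    - In a cell with no stopped ancestor, Markov's inequality bounds the density of
      the superlevel set by 1/4 at every scale. Approximating Borel sets by unions
      of cells shows that a set of density at most 1/4 in all the cells it meets is
      null; this replaces the Lebesgue differentiation theorem. *)
Require Import Defs.
From HB Require Import structures.
From mathcomp Require Import all_boot all_order all_algebra.
From mathcomp Require Import all_classical all_reals all_analysis.
From mathcomp Require Import measurable_realfun.
From mathcomp Require Import ring lra.
Set Implicit Arguments.
Unset Strict Implicit.
Unset Printing Implicit Defensive.
Import Order.TTheory GRing.Theory Num.Theory.
Import numFieldNormedType.Exports.
Local Open Scope classical_set_scope.
Local Open Scope ring_scope.

(** * Lebesgue measure of boxes *)

Section boxes.
Context {R : realType} {n : nat}.
Local Notation mu := (lebesgue R n).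

Lemma lebesgue_measure_co (a b : R) : a <= b ->
  lebesgue_measure (`[a, b[%classic : set R) = (b - a)%:E.
Proof.
move=> ab; rewrite lebesgue_measure_itv/= lte_fin; case: ltP => // h.
by have -> : b - a = 0 by lra.
Qed.

Lemma measurable_rV_coord_preimage k (i : 'I_k) (B : set R) :
  measurable (B : set (measurableTypeR R)) ->
  measurable [set y : 'rV[R]_k | B (y ord0 i)].
Proof.
move=> mB; rewrite -[X in measurable X]setTI.
exact: (measurable_rV_coord i measurableT).
Qed.

Lemma rV_cons0 k (z : measurableTypeR R * 'rV[R]_k) :
  rV_cons z ord0 ord0 = z.1.
Proof. exact: (congr1 fst (rV_consK z)). Qed.

Lemma rV_consS k (z : measurableTypeR R * 'rV[R]_k) (i : 'I_k) :
  rV_cons z ord0 (lift ord0 i) = z.2 ord0 i.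
Proof. by have /rowP/(_ i) := congr1 snd (rV_consK z); rewrite mxE. Qed.

Lemma measurable_cube k (x : 'rV[R]_k) (l : R) : measurable (cube x l).
Proof.
rewrite (_ : cube x l = \bigcap_(i in [set: 'I_k])
    [set y | `[x ord0 i - l / 2, x ord0 i + l / 2[%classic (y ord0 i)]); last first.
  apply/seteqP; split=> y /= h i => [_|]; first by rewrite /= in_itv/=.
  by have := h i I; rewrite /= in_itv/=.
apply: fin_bigcap_measurable => // i _.
apply: measurable_rV_coord_preimage; exact: measurable_itv.
Qed.

(** Induction on the dimension: peeling off the first coordinate turns the cube into an interval
    times a cube. *)
Lemma lebesgue_rV_cube k (x : 'rV[R]_k) (l : R) : 0 <= l ->
  lebesgue_rV k (cube x l) = (l ^+ k)%:E.
Proof.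
move=> l0; elim: k x => [|k IH] x /=.
  rewrite diracE expr0 mem_set//; by case.
rewrite /lebesgue_rV_step /pushforward.
rewrite (_ : _ @^-1` _ = `[x ord0 ord0 - l / 2, x ord0 ord0 + l / 2[%classic
    `*` cube (\row_i x ord0 (lift ord0 i)) l).
  etransitivity.
    apply: (@product_measure1E _ _ _ _ R lebesgue_measure (lebesgue_rV k)) => //.
    exact: measurable_cube.
  rewrite exprS EFinM; congr (_ * _)%E; last exact: IH.
  have E : x ord0 ord0 + l / 2 - (x ord0 ord0 - l / 2) = l by lra.
  rewrite -[in RHS]E; apply: lebesgue_measure_co; lra.
apply/seteqP; split=> -[a y]; rewrite /cube /= in_itv/=.
  move=> h; split=> [|i]; first by have := h ord0; rewrite rV_cons0.
  by have := h (lift ord0 i); rewrite mxE rV_consS.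
move=> [h1 h2] i; case: (unliftP ord0 i) => [j|] ->; last by rewrite rV_cons0.
by have := h2 j; rewrite mxE rV_consS.
Qed.

Lemma measurable_spacetime (A : set ('rV[R]_n * measurableTypeR R)) :
  measurable A -> measurable (A : set (spacetime R n)).
Proof. exact: caratheodory_measurable_mu_ext. Qed.

Lemma lebesgueE (A : set ('rV[R]_n * measurableTypeR R)) :
  measurable A -> mu A = borel_lebesgue R n A.
Proof. exact: measurable_mu_extE. Qed.

Lemma measurable_box (x : 'rV[R]_n) (l a b : R) :
  measurable (cube x l `*` `[a, b[ : set (spacetime R n)).
Proof.
apply: measurable_spacetime; apply: measurableX; first exact: measurable_cube.
exact: measurable_itv.
Qed.

Lemma lebesgue_box (x : 'rV[R]_n) (l a b : R) : 0 <= l -> a <= b ->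
  mu (cube x l `*` `[a, b[) = (l ^+ n * (b - a))%:E.
Proof.
move=> l0 ab; rewrite lebesgueE; last first.
  by apply: measurableX; [exact: measurable_cube|exact: measurable_itv].
etransitivity.
  apply: (@product_measure1E _ _ _ _ R (lebesgue_rV n) lebesgue_measure) => //.
  exact: measurable_cube.
rewrite EFinM; congr (_ * _)%E; first exact: lebesgue_rV_cube.
exact: lebesgue_measure_co.
Qed.

(** The completed measure is an infimum over countable Borel covers; the union of a nearly optimal
    cover serves as [B]. This carries arguments about Borel sets over to Lebesgue measurable
    ones. *)
Lemma lebesgue_outer_borel (A : set (spacetime R n)) (e : R) :
  (mu A < +oo)%E -> 0 < e ->
  exists B : set ('rV[R]_n * measurableTypeR R),
    [/\ measurable B, A `<=` B & (mu B <= mu A + e%:E)%E].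
Proof.
move=> fA e0.
have fA' : mu A \is a fin_num by rewrite ge0_fin_numE.
have [_ [F [mF AF] <-] hF] := @lb_ereal_inf_adherent R _ _ e0 fA'.
exists (\bigcup_k F k); split => //; first exact: bigcup_measurable.
apply: ltW; refine (le_lt_trans _ hF).
rewrite lebesgueE; last exact: bigcup_measurable.
apply: measure_sigma_subadditive => //; exact: bigcup_measurable.
Qed.

Lemma box_integrable (f : spacetime R n -> R) (x : 'rV[R]_n) (l a b : R) :
  locally_integrable_spacetime f ->
  mu.-integrable (cube x l `*` `[a, b[) (EFin \o f).
Proof.
move=> [mf hf].
(* Local integrability speaks of compact sets, so the half-open box is placed in a closed one. *)
pose C := [set y : 'rV[R]_n | forall i,
  `[x ord0 i - l / 2, x ord0 i + l / 2]%classic (y ord0 i)].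
have cC : compact C.
  apply: (@rV_compact R n (fun i => `[x ord0 i - l / 2, x ord0 i + l / 2]%classic)).
  by move=> i; exact: segment_compact.
have cK := compact_setX cC (@segment_compact R a b).
apply: (integrableS _ _ _ (hf _ cK)).
- apply: measurable_spacetime; apply: measurableX; last exact: measurable_itv.
  rewrite (_ : C = \bigcap_(i in [set: 'I_n])
    [set y | `[x ord0 i - l / 2, x ord0 i + l / 2]%classic (y ord0 i)]).
    apply: fin_bigcap_measurable => // i _.
    apply: measurable_rV_coord_preimage; exact: measurable_itv.
  by apply/seteqP; split=> y /= h i => [_|]; [exact: h|exact: (h i I)].
- exact: measurable_box.
- move=> [y s] /= [h1]; rewrite !in_itv/= => /andP[as_ sb]; split.
    by move=> i; have /andP[h2 h3] := h1 i; rewrite /= in_itv/= h2 ltW.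
  by rewrite as_ ltW.
Qed.

End boxes.
(** * Countable unions and Vitali selection *)

Section countable_unions.
Local Open Scope ereal_scope.
Context d (T : measurableType d) (R : realType) (I : countType).
Variable mu : {measure set T -> \bar R}.
Implicit Types (P : set I) (B : I -> set T).

(** Slices indexed by [nat] through [pickle]: by injectivity each is empty or a single [B i], so a
    countable union is handled as a sequence. *)
Let level P B k : set T := [set z | exists i, [/\ P i, pickle i = k & B i z]].

Let bigcup_level P B : \bigcup_(i in P) B i = \bigcup_k level P B k.
Proof.
apply/seteqP; split=> z /=.
  by move=> [i Pi Bi]; exists (pickle i) => //; exists i.
by move=> [k _ [i [Pi _ Bi]]]; exists i.
Qed.

Let levelE P B k : level P B k = set0 \/ exists2 i, P i & level P B k = B i.
Proof.
have [[i [Pi ik]]|h] := pselect (exists i, P i /\ pickle i = k).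
  right; exists i => //; apply/seteqP; split=> z /=; last by exists i.
  by move=> [j [_ + Bj]]; rewrite -ik => /(pcan_inj pickleK) <-.
left; rewrite -subset0 => z [i [Pi ik _]]; apply: h; by exists i.
Qed.

Let measurable_level P B : (forall i, P i -> measurable (B i)) ->
  forall k, measurable (level P B k).
Proof. by move=> mB k; have [->//|[i Pi ->]] := levelE P B k; exact: mB. Qed.

Lemma countable_bigcup_measurable P B : (forall i, P i -> measurable (B i)) ->
  measurable (\bigcup_(i in P) B i).
Proof.
by move=> mB; rewrite bigcup_level; apply: bigcup_measurable => k _; exact: measurable_level.
Qed.

Lemma le_measure_bigcup_density P B (E : set T) (c : R) : (0 <= c)%R ->
  (forall i, P i -> measurable (B i)) -> trivIset P B -> measurable E ->
  (forall i, P i -> mu (E `&` B i) <= c%:E * mu (B i)) ->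
  mu (E `&` \bigcup_(i in P) B i) <= c%:E * mu (\bigcup_(i in P) B i).
Proof.
move=> c0 mB tB mE hE; have mF := measurable_level mB.
rewrite bigcup_level measure_bigcup//; last first.
  move=> k l _ _ [z [[i [Pi <- Bi]] [j [Pj <- Bj]]]]; congr pickle.
  by apply: tB => //; exists z.
rewrite setI_bigcupr -nneseriesZl//.
apply: (@le_trans _ _ (\sum_(0 <= k <oo) mu (E `&` level P B k))).
  apply: measure_sigma_subadditive => //.
  - by move=> k; apply: measurableI.
  - by apply: bigcup_measurable => k _; apply: measurableI.
rewrite [leRHS](@eq_eseriesl _ _ xpredT); last first.
  by move=> k; rewrite in_setT.
apply: lee_nneseries => // k _.
have [->|[i Pi ->]] := levelE P B k; last exact: hE.
by rewrite setI0 measure0 mule0.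
Qed.

(** Continuity from below along finite unions. It reduces the covering argument to finite families,
    where a greedy selection terminates. *)
Lemma measure_bigcup_le_finite P B (b : \bar R) :
  (forall i, P i -> measurable (B i)) ->
  (forall s : seq I, (forall i, i \in s -> P i) ->
    mu (\bigcup_(i in [set` s]) B i) <= b) ->
  mu (\bigcup_(i in P) B i) <= b.
Proof.
move=> mB hb; rewrite bigcup_level.
pose F k := \bigcup_(j < k) level P B j.
have mF k : measurable (F k).
  by apply: bigcup_measurable => j _; exact: measurable_level.
have -> : \bigcup_k level P B k = \bigcup_k F k.
  apply/seteqP; split=> z [k _]; first by exists k.+1 => //; exists k => /=.
  by move=> [j _ ?]; exists j.
have ndF : {homo F : k m / (k <= m)%N >-> (k <= m)%O}.
  move=> k m km; apply/subsetPset => z [j /= jk jz]; exists j => //=.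
  exact: leq_trans km.
have := nondecreasing_cvg_mu mF (bigcup_measurable (fun k _ => mF k)) ndF (mu := mu).
move=> cvF; rewrite -(cvg_lim _ cvF)//; apply: lime_le; first by apply/cvg_ex; eexists; exact: cvF.
apply: nearW => k /=.
pose s := [seq i <- pmap (@pickle_inv I) (iota 0 k) | `[<P i>]].
apply: le_trans (hb s _); last first.
  by move=> i; rewrite mem_filter => /andP[/asboolP].
have sP i : i \in s -> P i by rewrite mem_filter => /andP[/asboolP].
apply: le_measure; rewrite ?inE//.
  apply: countable_bigcup_measurable => i /= /sP; exact: mB.
move=> z [j /= jk [i [Pi ij Bi]]]; exists i => //=.
rewrite mem_filter; apply/andP; split; first exact/asboolP.
rewrite mem_pmap; apply/mapP; exists (pickle i); last by rewrite pickleK_inv.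
by rewrite mem_iota /= ij.
Qed.

(** Greedy selection. Take [i] of least level: every [B j] whose [A j] meets [A i] is absorbed by
    [D i], and the other [A j] avoid [A i], so the induction applies to them in the complement.
    Superadditivity of [nu] adds up the two bounds. Disjointness is tested on [A] rather than on the
    covered sets [B], because averages live on upper parts of rectangles while cells lie earlier in
    time. *)
Lemma vitali_finite (nu : set T -> \bar R) (lev : I -> nat)
    (A B D : I -> set T) (c : R) (P : set I) : (0 <= c)%R ->
  (forall X, 0 <= nu X) ->
  (forall X Y, measurable X -> measurable Y -> Y `<=` X ->
    nu Y + nu (X `\` Y) <= nu X) ->
  (forall i, P i -> [/\ measurable (A i), measurable (B i), measurable (D i),
    A i !=set0 & mu (D i) <= c%:E * nu (A i)]) ->
  (forall i j, P i -> P j -> (lev i <= lev j)%N -> A i `&` A j !=set0 ->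
    B j `<=` D i) ->
  forall (X : set T) (s : seq I), measurable X ->
  (forall i, i \in s -> P i /\ A i `<=` X) ->
  mu (\bigcup_(i in [set` s]) B i) <= c%:E * nu X.
Proof.
move=> c0 nu0 nuD hP hD X s; have [m] := ubnP (size s).
elim: m X s => // m IH X [|i0 s0] sm mX hs.
  by rewrite set_nil bigcup_set0 measure0 mule_ge0.
set s := i0 :: s0 in sm hs *.
have [i [si imin]] : exists i, i \in s /\ forall j, j \in s -> (lev i <= lev j)%N.
  have ex : exists k, has (fun i => lev i == k) s.
    by exists (lev i0); rewrite /= eqxx.
  case: (ex_minnP ex) => k /hasP[i si /eqP <-] hk; exists i; split=> // j sj.
  by apply: hk; apply/hasP; exists j.
have [[Pi AX] [mA mB mD nA muD]] := (hs i si, hP i (hs i si).1).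
pose s' := [seq j <- s | `[<A i `&` A j = set0>]].
have s's j : j \in s' -> j \in s by rewrite mem_filter => /andP[].
have mbig (r : seq I) (r_s : {subset r <= s}) : measurable (\bigcup_(j in [set` r]) B j).
  by apply: countable_bigcup_measurable => j /= /r_s/hs[/hP[]].
have IHs : mu (\bigcup_(j in [set` s']) B j) <= c%:E * nu (X `\` A i).
  apply: IH; last 1 first.
  - move=> j; rewrite mem_filter => /andP[/asboolP AA /hs[Pj Aj]].
    split=> // z Az; split; [exact: Aj|move=> Aiz].
    by have : set0 z by rewrite -AA.
  (* As [A i] is nonempty, [i] itself is discarded, so the list gets shorter. *)
  - rewrite ltnS in sm; apply: leq_trans sm; rewrite size_filter.
    rewrite -[ltnRHS](count_predC (fun j => `[<A i `&` A j = set0>])).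
    rewrite -[ltnLHS]addn0 ltn_add2l -has_count; apply/hasP; exists i => //=.
    by rewrite setIid; apply/asboolPn => A0; case: nA => x; rewrite A0.
  - exact: measurableD.
apply: (@le_trans _ _ (mu (D i `|` \bigcup_(j in [set` s']) B j))).
  apply: le_measure; rewrite ?inE//; first exact: mbig.
    by apply: measurableU => //; apply: mbig.
  move=> z [j /= js Bz]; have [AA|AA] := pselect (A i `&` A j = set0).
    by right; exists j => //=; rewrite mem_filter js andbT; exact/asboolP.
  left; apply: (hD i j) => //; first exact: (hs j js).1.
    exact: imin.
  by apply/set0P/eqP.
apply: (le_trans (measureU2 _ _ _)) => //; first exact: mbig.
apply: (le_trans (leeD muD IHs)); rewrite -muleDr//; first exact/lee_wpmul2l/nuD.
by apply: ge0_adde_def; rewrite inE.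
Qed.

End countable_unions.
(** * Dyadic approximation of Borel sets *)

Section refinement.
Context {R : realType}.

(** The coarse floor is determined by comparing [u / a] with multiples of [q]; these are integers,
    so the fine floor decides the comparisons. *)
Lemma floor_eq_coarse (u v a : R) (q : nat) : 0 < a -> (0 < q)%N ->
  Num.floor (u / a) = Num.floor (v / a) ->
  Num.floor (u / (q%:R * a)) = Num.floor (v / (q%:R * a)).
Proof.
move=> a0 q0 uv; have q0' : 0 < q%:R :> R by rewrite ltr0n.
have key (w : R) : w / (q%:R * a) = (w / a) / q%:R.
  by rewrite invfM mulrCA mulrC.
rewrite !key; set N := Num.floor (u / a / _); apply/esym/eqP.
have /andP[N1 N2] : N%:~R <= u / a / q%:R < (N + 1)%:~R by exact: floor_itv.
rewrite floor_eq ler_pdivlMr// ltr_pdivrMr//.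
have e (M : int) : M%:~R * q%:R = (M * q%:Z)%:~R :> R by rewrite intrM.
rewrite !e -floor_ge_int -floor_lt_int -uv floor_ge_int floor_lt_int -!e.
by rewrite -ler_pdivlMr// N1 -ltr_pdivrMr.
Qed.

Definition refines (l : nat -> R) := forall k, exists q : nat, l k = q%:R * l k.+1.

Lemma refines_le (l : nat -> R) : (forall k, 0 < l k) -> refines l ->
  forall k m, (k <= m)%N -> exists2 q : nat, (0 < q)%N & l k = q%:R * l m.
Proof.
move=> l0 lr k m /subnKC <-; elim: (m - k)%N => [|j [q q0 ->]].
  by exists 1%N => //; rewrite addn0 mul1r.
have [q' e] := lr (k + j)%N; exists (q * q')%N; last first.
  by rewrite addnS natrM e mulrA.
rewrite muln_gt0 q0/= lt0n; apply/eqP => q'0.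
by have := l0 (k + j)%N; rewrite e q'0 mul0r ltxx.
Qed.

Lemma refines_small (l : nat -> R) : (forall k, 0 < l k) -> refines l ->
  forall k m, (k <= m)%N -> l m <= l k.
Proof.
move=> l0 lr k m /(refines_le l0 lr)[q q0 ->].
by rewrite ler_peMl ?ler1n// ltW.
Qed.

End refinement.

(* Level, then the spatial and the temporal index on the grid of that level. *)
Definition cell (n : nat) := (nat * ({ffun 'I_n -> int} * int))%type.

(** * Half-open cells: nesting, disjointness, unions of cells *)

Section grid.
Context {R : realType} {n : nat}.
Variables (x0 : 'rV[R]_n) (s0 : R) (l tau : nat -> R).
Hypotheses (l_gt0 : forall k, 0 < l k) (tau_gt0 : forall k, 0 < tau k).
Hypotheses (l_ref : refines l) (tau_ref : refines tau).
Local Notation mu := (lebesgue R n).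
Local Notation ST := (spacetime R n).

Definition cell_at (k : nat) (z : ST) : cell n :=
  (k, ([ffun i => Num.floor ((z.1 ord0 i - x0 ord0 i) / l k)],
       Num.floor ((z.2 - s0) / tau k))).

Definition cell_center (c : cell n) : 'rV[R]_n :=
  \row_i (x0 ord0 i + (c.2.1 i)%:~R * l c.1 + l c.1 / 2).

Definition cell_start (c : cell n) : R := s0 + c.2.2%:~R * tau c.1.

Definition cell_box (c : cell n) : set ST :=
  cube (cell_center c) (l c.1) `*` `[cell_start c, cell_start c + tau c.1[.

Lemma floor_divE (u a : R) (j : int) : 0 < a ->
  (Num.floor (u / a) == j) = (j%:~R * a <= u < j%:~R * a + a).
Proof.
by move=> a0; rewrite floor_eq ler_pdivlMr// ltr_pdivrMr// intrD mulrDl mul1r.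
Qed.

(** Membership becomes an equation between indices, so disjointness and nesting of cells reduce to
    rewriting. *)
Lemma cell_boxP (c : cell n) z : cell_box c z <-> cell_at c.1 z = c.
Proof.
case: c => k [a j]; rewrite /cell_box /cell_at /cube /cell_center /cell_start /=.
split.
  move=> [h1]; rewrite in_itv/= => h2; congr (_, (_, _)); last first.
    by apply/eqP; rewrite floor_divE//; lra.
  apply/ffunP => i; rewrite ffunE; apply/eqP; rewrite floor_divE//.
  by have := h1 i; rewrite mxE/=; lra.
move=> [<- <-]; split=> [i|].
  rewrite mxE/= ffunE.
  have := eqxx (Num.floor ((z.1 ord0 i - x0 ord0 i) / l k)).
  by rewrite floor_divE//; lra.
rewrite in_itv/=.
have := eqxx (Num.floor ((z.2 - s0) / tau k)).
by rewrite floor_divE//; lra.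
Qed.

Lemma cell_at_box k z : cell_box (cell_at k z) z.
Proof. exact/cell_boxP. Qed.

Lemma cell_box_at k z w : cell_box (cell_at k z) w <-> cell_at k w = cell_at k z.
Proof. exact: cell_boxP. Qed.

Lemma cell_at_coarse k m z w : (k <= m)%N ->
  cell_at m z = cell_at m w -> cell_at k z = cell_at k w.
Proof.
move=> km [/ffunP h1 h2].
have [q q0 lq] := refines_le l_gt0 l_ref km.
have [q' q0' tq] := refines_le tau_gt0 tau_ref km.
congr (_, (_, _)); last by rewrite tq; exact: floor_eq_coarse.
apply/ffunP => i; have := h1 i; rewrite !ffunE lq; exact: floor_eq_coarse.
Qed.

Lemma measurable_cell_box c : measurable (cell_box c).
Proof. exact: measurable_box. Qed.

Lemma lebesgue_cell_box c : mu (cell_box c) = (l c.1 ^+ n * tau c.1)%:E.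
Proof.
rewrite /cell_box lebesgue_box; first by congr (_ * _)%:E; lra.
  exact: ltW.
by rewrite lerDl ltW.
Qed.

Lemma trivIset_cell_box (P : set (cell n)) :
  (forall c1 c2 z, P c1 -> P c2 -> cell_box c1 z -> cell_box c2 z -> c1.1 = c2.1) ->
  trivIset P cell_box.
Proof.
move=> h c1 c2 P1 P2 [z [z1 z2]]; have e := h _ _ _ P1 P2 z1 z2.
by move/cell_boxP : z1 => <-; move/cell_boxP : z2; rewrite e.
Qed.

(** Equivalently, [D] is a union of cells of level [k]. *)
Definition saturated (k : nat) (D : set ST) :=
  forall z w, cell_at k z = cell_at k w -> D z -> D w.

Lemma saturated_fine k m D : (k <= m)%N -> saturated k D -> saturated m D.
Proof. by move=> km sD z w /(cell_at_coarse km); exact: sD. Qed.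

Lemma saturatedE k D : saturated k D ->
  D = \bigcup_(c in [set c | c.1 = k /\ cell_box c `<=` D]) cell_box c.
Proof.
move=> sD; apply/seteqP; split=> z; last by move=> [c [_ cD] /cD].
move=> Dz; exists (cell_at k z); last exact: cell_at_box.
by split=> // w /cell_box_at/esym zw; exact: sD Dz.
Qed.

Lemma measurable_saturated k D : saturated k D -> measurable D.
Proof.
move=> /saturatedE ->; apply: countable_bigcup_measurable => c _.
exact: measurable_cell_box.
Qed.

Section approximation.
Hypotheses (l_lim : forall e, 0 < e -> exists k, l k < e).
Hypotheses (tau_lim : forall e, 0 < e -> exists k, tau k < e).
Variable X : set ST.
Hypotheses (mX : measurable X) (Xoo : (mu X < +oo)%E).

(** The error is measured inside the window [X], whose finite measure gives continuity from above
    for countable unions. *)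
Definition approximable (A : set ST) := measurable A /\
  forall e, 0 < e -> exists k D, saturated k D /\
    (mu (X `&` ((A `\` D) `|` (D `\` A))) <= e%:E)%E.

Lemma approximable_saturated k D : saturated k D -> approximable D.
Proof.
move=> sD; split; first exact: measurable_saturated sD.
move=> e e0; exists k, D; split=> //.
by rewrite setDv setU0 setI0 measure0 lee_fin ltW.
Qed.

Lemma approximableC A : approximable A -> approximable (~` A).
Proof.
move=> [mA hA]; split; first exact: measurableC.
move=> e /hA[k [D [sD AD]]]; exists k, (~` D); split.
  by move=> z w zw nDz Dw; apply: nDz; exact: sD Dw.
by rewrite !setDE !setCK [X in X `|` _]setIC [X in _ `|` X]setIC setUC -!setDE.
Qed.

Lemma approximableU A B : approximable A -> approximable B -> approximable (A `|` B).
Proof.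
move=> [mA hA] [mB hB]; split; first exact: measurableU.
move=> e e0; have e20 : 0 < e / 2 by lra.
have [k1 [D1 [sD1 AD1]]] := hA _ e20; have [k2 [D2 [sD2 AD2]]] := hB _ e20.
have {}sD1 := saturated_fine (leq_maxl k1 k2) sD1.
have {}sD2 := saturated_fine (leq_maxr k1 k2) sD2.
have mD1 := measurable_saturated sD1; have mD2 := measurable_saturated sD2.
exists (maxn k1 k2), (D1 `|` D2); split.
  by move=> z w zw [?|?]; [left; apply: sD1 zw _|right; apply: sD2 zw _].
rewrite [e]splitr EFinD; apply: le_trans (leeD AD1 AD2).
set Y1 := X `&` _; set Y2 := X `&` (_ `|` (D2 `\` _)).
have mS (S S' : set ST) : measurable S -> measurable S' ->
    measurable (X `&` ((S `\` S') `|` (S' `\` S))).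
  by move=> ? ?; apply: measurableI => //; apply: measurableU; exact: measurableD.
apply: le_trans (measureU2 _ _ _); rewrite ?/Y1 ?/Y2; try exact: mS.
apply: le_measure; rewrite ?inE.
- by apply: mS; exact: measurableU.
- by apply: measurableU; exact: mS.
move=> z [Xz]; rewrite /setD /setU /setI /=.
have [] := pselect (A z); have [] := pselect (B z);
  have [] := pselect (D1 z); have [] := pselect (D2 z); tauto.
Qed.

Lemma approximable_bigcup (F : nat -> set ST) : (forall i, approximable (F i)) ->
  approximable (\bigcup_i F i).
Proof.
move=> hF; have mF : measurable (\bigcup_i F i).
  by apply: bigcup_measurable => i _; exact: (hF i).1.
split => // e e0; have e20 : 0 < e / 2 by lra.
pose U N := \bigcup_(i < N) F i.
have hU N : approximable (U N).
  elim: N => [|N IH].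
    by rewrite /U bigcup_mkord big_ord0; apply: (@approximable_saturated 0) => z w.
  by rewrite /U bigcup_mkord big_ord_recr -bigcup_mkord; exact: approximableU.
have mU N : measurable (U N) by exact: (hU N).1.
(* The tails of the union decrease to the empty set, so a finite union can replace the countable one
   at a cost of [e / 2]. *)
pose V N := X `&` (\bigcup_i F i `\` U N).
have mV N : measurable (V N) by apply: measurableI => //; exact: measurableD.
have V0 : \bigcap_N V N = set0.
  rewrite -subset0 => z Vz; have [_ [[i _ Fi] _]] := Vz 0%N I.
  by have [_ [_]] := Vz i.+1 I; apply; exists i => /=.
have [N VN] : exists N, (mu (V N) <= (e / 2)%:E)%E.
  apply: contrapT => /forallNP h.
  have cV : (mu \o V) N @[N --> \oo] --> mu (\bigcap_N V N).
    apply: nonincreasing_cvg_mu => //.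
    - apply: le_lt_trans Xoo; apply: le_measure; rewrite ?inE//.
      by move=> z [].
    - by rewrite V0.
    - move=> a b ab; apply/subsetPset => z [Xz [Fz nU]]; split=> //; split=> // -[i /= ia Fi].
      by apply: nU; exists i => //=; exact: leq_trans ab.
  have : ((e / 2)%:E <= limn (mu \o V))%E.
    apply: lime_ge; first by apply/cvg_ex; eexists; exact: cV.
    by apply: nearW => a; apply/ltW; rewrite ltNge; apply/negP => /h.
  by rewrite (cvg_lim _ cV)// V0 measure0 lee_fin; lra.
have [k [D [sD UD]]] := (hU N).2 _ e20; have mD := measurable_saturated sD.
exists k, D; split => //.
rewrite [e]splitr EFinD; apply: le_trans (leeD VN UD).
have mS (S : set ST) : measurable S ->
    measurable (X `&` ((S `\` D) `|` (D `\` S))).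
  by move=> ?; apply: measurableI => //; apply: measurableU; exact: measurableD.
apply: le_trans (measureU2 _ _ _) => //; last exact: mS.
apply: le_measure; rewrite ?inE.
- exact: mS.
- by apply: measurableU => //; exact: mS.
have UF : U N `<=` \bigcup_i F i by move=> z [i _ Fi]; exists i.
move=> z [Xz]; move: (UF z); rewrite /V /setD /setU /setI /=.
have [] := pselect ((\bigcup_i F i) z); have [] := pselect (U N z); tauto.
Qed.

(** The points whose cell of level [k] lies in [A] form a saturated set, and these countably many
    sets exhaust [A]. *)
Lemma approximable_open A :
  (forall z, A z -> exists k, cell_box (cell_at k z) `<=` A) -> approximable A.
Proof.
move=> hA; rewrite (_ : A = \bigcup_k [set z | cell_box (cell_at k z) `<=` A]).
  apply: approximable_bigcup => k; apply: (@approximable_saturated k) => z w zw /=.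
  by rewrite zw.
apply/seteqP; split=> [z /hA[k hk]|z [k _]]; first by exists k.
by apply; exact: cell_at_box.
Qed.

(** Approximable sets form a sigma-algebra, so only generators matter. These are coordinate
    half-spaces, which are open and hence contain a small cell around each of their points. *)
Lemma approximable_borel (A : set ('rV[R]_n * measurableTypeR R)) :
  measurable A -> approximable A.
Proof.
move=> mA.
have sG : sigma_algebra setT approximable.
  split; first by apply: (@approximable_saturated 0) => z w.
  - by move=> B hB; rewrite setTD; exact: approximableC.
  - exact: approximable_bigcup.
pose GT := g_sigma_algebraType approximable.
have GTE (B : set GT) : measurable B = approximable B.
  by rewrite -[RHS](congr1 (@^~ B) (sigma_algebra_id sG)).
(* With the approximable sets as source sigma-algebra, measurability of the identity says that Borel
   sets are approximable, and it can be checked coordinatewise. *)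
have : measurable_fun [set: GT] (fun z : GT => (z : 'rV[R]_n * measurableTypeR R)).
  apply/measurable_fun_pairP; split.
    apply: measurable_fun_rVP => i.
    apply: (measurability _ (RGenInftyO.measurableE R)) => //.
    move=> _ [_ [a ->] <-]; rewrite setTI GTE.
    apply: approximable_open => z; rewrite /= in_itv/= => za.
    have [k lk] := l_lim (ltac:(lra) : 0 < a - z.1 ord0 i).
    exists k => w /cell_box_at[/ffunP/(_ i) + _] /=; rewrite !ffunE in_itv/= => e.
    have := eqxx (Num.floor ((z.1 ord0 i - x0 ord0 i) / l k)).
    by move: (e) => /eqP; rewrite !floor_divE//; lra.
  apply: (measurability _ (RGenInftyO.measurableE R)) => //.
  move=> _ [_ [a ->] <-]; rewrite setTI GTE.
  apply: approximable_open => z; rewrite /= in_itv/= => za.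
  have [k lk] := tau_lim (ltac:(lra) : 0 < a - z.2).
  exists k => w /cell_box_at[_ e] /=; rewrite in_itv/=.
  have := eqxx (Num.floor ((z.2 - s0) / tau k)).
  by move: (e) => /eqP; rewrite !floor_divE//; lra.
by move=> /(_ measurableT A mA); rewrite setTI GTE.
Qed.

(** Enclose [E] in a Borel set [B] of nearly the same measure and replace [B] by a union [D] of
    cells. In [X], the set [D] captures nearly all of [E] and has measure hardly above that of [E],
    yet [E] fills at most a quarter of it. *)
Lemma null_of_low_density (k0 : nat) (E : set ST) : saturated k0 X ->
  measurable E -> E `<=` X ->
  (forall k z, (k0 <= k)%N -> E z ->
    (mu (E `&` cell_box (cell_at k z)) <=
     (4^-1)%:E * mu (cell_box (cell_at k z)))%E) ->
  mu E = 0%E.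
Proof.
move=> sX mE EX hE.
have Eoo : (mu E < +oo)%E by apply: le_lt_trans Xoo; apply: le_measure; rewrite ?inE.
have Efin : mu E \is a fin_num by rewrite ge0_fin_numE.
apply/eqP; rewrite eq_le measure_ge0 andbT -(fineK Efin) lee_fin.
apply/ler_addgt0Pl => e e0; rewrite addr0.
have [B [mB EB muB]] := lebesgue_outer_borel Eoo (ltac:(lra) : 0 < e / 3).
have [_ /(_ (e / 3) ltac:(lra))[k [D [sD BD]]]] := approximable_borel mB.
have {}mB := measurable_spacetime mB.
have mBD : measurable (X `&` ((B `\` D) `|` (D `\` B))).
  have mD := measurable_saturated sD.
  by apply: measurableI => //; apply: measurableU; exact: measurableD.
(* At this level both [D] and [X] are unions of cells and the density hypothesis is available. *)
pose m := maxn k k0.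
have {}sD : saturated m (D `&` X).
  move=> z w zw [Dz Xz]; split.
    exact: (saturated_fine (leq_maxl k k0) sD zw).
  exact: (saturated_fine (leq_maxr k k0) sX zw).
have mD : measurable (D `&` X) := measurable_saturated sD.
have : (mu (E `&` (D `&` X)) <= (4^-1)%:E * mu (D `&` X))%E.
  rewrite {1}(saturatedE sD) {2}(saturatedE sD).
  apply: le_measure_bigcup_density => //.
  - by move=> c _; exact: measurable_cell_box.
  - by apply: trivIset_cell_box => c1 c2 z [-> _] [-> _].
  move=> c [cm cD]; have [[z [Ez cz]]|] := pselect (E `&` cell_box c !=set0).
    move/cell_boxP : cz; rewrite cm => <-; apply: hE => //; exact: leq_maxr.
  by move=> /set0P/negP/negPn/eqP ->; rewrite measure0 mule_ge0.
have h1 : (mu (D `&` X) <= mu B + (e / 3)%:E)%E.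
  apply: le_trans (leeD (lexx _) BD); apply: le_trans (measureU2 _ _ _) => //.
  apply: le_measure; rewrite ?inE//; first exact: measurableU.
  move=> z [Dz Xz]; have [Bz|nBz] := pselect (B z); first by left.
  by right; split=> //; right.
have h2 : (mu E <= mu (E `&` (D `&` X)) + (e / 3)%:E)%E.
  apply: le_trans (leeD (lexx _) BD).
  apply: le_trans (measureU2 _ _ _) => //; last exact: measurableI.
  apply: le_measure; rewrite ?inE//; first by apply: measurableU => //; exact: measurableI.
  move=> z Ez; have [Dz|nDz] := pselect (D z).
    by left; split=> //; split=> //; exact: EX.
  by right; split; [exact: EX|left; split=> //; exact: EB].
have Dfin : mu (D `&` X) \is a fin_num.
  by rewrite ge0_fin_numE//; apply: le_lt_trans Xoo; apply: le_measure; rewrite ?inE// => z [].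
have EDfin : mu (E `&` (D `&` X)) \is a fin_num.
  rewrite ge0_fin_numE//; apply: le_lt_trans Eoo; apply: le_measure; rewrite ?inE//.
  exact: measurableI.
have : (mu (D `&` X) <= mu E + (e / 3)%:E + (e / 3)%:E)%E.
  by apply: le_trans h1 _; rewrite leeD2r.
(* The estimates combine to [mu E <= (mu E + 2 e / 3) / 4 + e / 3], hence [mu E <= 2 e / 3]. *)
move: h2; rewrite -(fineK Dfin) -(fineK EDfin) -(fineK Efin) -!EFinD -EFinM !lee_fin.
by move=> *; lra.
Qed.

End approximation.
End grid.
(** * Mean excess over a level *)

Section excess.
Local Open Scope ereal_scope.
Context d (T : measurableType d) (R : realType).
Variable mu : {measure set T -> \bar R}.
Implicit Types (f : T -> R) (U X Y : set T).

Definition excess f (a : R) (z : T) : \bar R := (Num.max (f z - a) 0)%:E.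

Lemma excess_ge0 f a z : 0 <= excess f a z.
Proof. by rewrite lee_fin le_max lexx orbT. Qed.

Lemma measurable_excess f a U :
  measurable_fun setT f -> measurable_fun U (excess f a).
Proof.
move=> mf; apply: measurable_funTS; apply/measurable_EFinP.
by apply: measurable_maxr => //; exact: measurable_funB.
Qed.

Lemma mean_excess f (a : R) U : measurable U -> 0 < mu U -> mu U < +oo ->
  mu.-integrable U (EFin \o f) ->
  (fine ((fine (mu U))^-1%:E * \int[mu]_(z in U) (f z)%:E) - a)%:E * mu U
    <= \int[mu]_(z in U) excess f a z.
Proof.
move=> mU U0 Uoo fi.
have Ufin : mu U \is a fin_num by rewrite ge0_fin_numE// ltW.
have V0 : (0 < fine (mu U))%R by rewrite fine_gt0// U0.
have Ifin : \int[mu]_(z in U) (f z)%:E \is a fin_num := integrable_fin_num mU fi.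
have ci : mu.-integrable U (cst a%:E).
  apply/integrableP; split; first exact: measurable_cst.
  by rewrite integral_cst//= lte_mul_pinfty.
rewrite (_ : _ * mu U = \int[mu]_(z in U) ((f z)%:E - a%:E)); last first.
  rewrite (@integralB _ _ _ _ _ mU (EFin \o f) (cst a%:E))//= integral_cst//.
  rewrite -(fineK Ufin) -(fineK Ifin) -!EFinM -EFinB; congr (_%:E).
  by rewrite /= mulrBl mulrAC mulVf ?mul1r// gt_eqF.
(* Dropping the negative part of [f - a] leaves the excess. *)
rewrite integralE -[leRHS]sube0; apply: leeB; last exact: integral_ge0.
rewrite le_eqVlt; apply/orP; left; apply/eqP; apply: eq_integral => z _.
by rewrite /excess EFin_max funeposE.
Qed.

Lemma markov_excess f (a m : R) U Y : measurable U -> measurable Y -> Y `<=` U ->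
  measurable_fun setT f -> (0 < m)%R ->
  m%:E * mu (Y `&` [set z | (a + m < f z)%R]) <= \int[mu]_(z in U) excess f a z.
Proof.
move=> mU mY YU mf m0.
have mS : measurable (Y `&` [set z | (a + m < f z)%R]).
  apply: measurableI => //.
  rewrite -[X in measurable X]setTI.
  have mI : measurable [set x : R | (a + m < x)%R].
    rewrite (_ : [set _ | _] = `](a + m)%R, +oo[%classic)//.
    by apply/seteqP; split=> x /=; rewrite in_itv/= andbT.
  exact: mf measurableT _ mI.
rewrite -(integral_cst _ mS).
apply: (@le_trans _ _ (\int[mu]_(z in Y `&` [set z | (a + m < f z)%R]) excess f a z)).
  apply: ge0_le_integral => //.
  - by move=> z _; rewrite lee_fin ltW.
  - exact: measurable_excess.
  - by move=> z [_ /= h]; rewrite lee_fin le_max; apply/orP; left; lra.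
apply: ge0_subset_integral => //.
- exact: measurable_excess.
- by move=> z _; exact: excess_ge0.
- by move=> z [/YU].
Qed.

Lemma integral_excess_setD f a X Y : measurable X -> measurable Y -> Y `<=` X ->
  measurable_fun setT f ->
  \int[mu]_(z in Y) excess f a z + \int[mu]_(z in X `\` Y) excess f a z
    = \int[mu]_(z in X) excess f a z.
Proof.
move=> mX mY YX mf; rewrite -ge0_integral_setU//.
- by rewrite setDUK.
- exact: measurableD.
- exact: measurable_excess.
- by move=> z _; exact: excess_ge0.
- by rewrite disj_set2E setDIK.
Qed.

End excess.
(** * Parabolic dyadic cells and their rectangles *)

Section scales.
Context {R : realType}.
Variables (p T L : R) (m : nat).
Hypotheses (p_gt1 : 1 < p) (T_gt0 : 0 < T) (L_gt0 : 0 < L) (m_gt0 : (0 < m)%N).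

Definition space_step (k : nat) : R := L / 2 ^+ (m * k).

(* The number of time bisections at level [k]: the least integer exponent for
   which [2 ^ -splits k] does not exceed the parabolic scaling [2 `^ -(m k p)]. *)
Definition splits (k : nat) : nat := `|Num.ceil ((m * k)%:R * p)|%N.

(** The parabolic ratio of durations need not be an integer; bisecting a whole number of times keeps
    the grids nested. With [T = 1 - alpha], level 0 has the duration of [R^-(alpha)]. *)
Definition time_step (k : nat) : R := T * L `^ p / 2 ^+ splits k.

Let p_ge0 : 0 <= p. Proof. by apply: ltW; apply: lt_trans p_gt1. Qed.

Let exponent_ge0 (k : nat) : 0 <= k%:R * p :> R.
Proof. by rewrite mulr_ge0. Qed.

Let splitsE k : (splits k)%:R = (Num.ceil ((m * k)%:R * p))%:~R :> R.
Proof.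
by rewrite /splits natr_absz ger0_norm// ceil_ge0; apply: lt_le_trans (exponent_ge0 _); lra.
Qed.

Lemma space_step_gt0 k : 0 < space_step k.
Proof. by rewrite divr_gt0// exprn_gt0. Qed.

Lemma time_step_gt0 k : 0 < time_step k.
Proof. by rewrite divr_gt0 ?exprn_gt0// mulr_gt0// powR_gt0. Qed.

Lemma space_stepS k : space_step k = 2 ^+ m * space_step k.+1.
Proof.
have h (j : nat) : 2 ^+ j != 0 :> R by rewrite expf_neq0.
by rewrite /space_step mulnS exprD; field; rewrite !h.
Qed.

Lemma refines_space_step : refines space_step.
Proof. by move=> k; exists (2 ^ m)%N; rewrite natrX; exact: space_stepS. Qed.

Lemma splits_mono k j : (k <= j)%N -> (splits k <= splits j)%N.
Proof.
move=> kj; rewrite -(ler_nat R) !splitsE ler_int; apply: le_ceil_tmp.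
by rewrite ler_wpM2r// ler_nat leq_mul2l kj orbT.
Qed.

Lemma refines_time_step : refines time_step.
Proof.
move=> k; exists (2 ^ (splits k.+1 - splits k))%N.
have h (j : nat) : 2 ^+ j != 0 :> R by rewrite expf_neq0.
rewrite natrX /time_step -{2}(subnKC (splits_mono (leqnSn k))) exprD.
by field; rewrite !h.
Qed.

Lemma powR_space_step k : space_step k `^ p = L `^ p * (2 `^ ((m * k)%:R * p))^-1.
Proof.
rewrite /space_step powRM ?invr_ge0 ?exprn_ge0//; last exact: ltW.
by rewrite -powR_inv1 ?exprn_ge0// -powRrM mulN1r powRN -powR_mulrn// -powRrM.
Qed.

(** Rounding the exponent up adds less than one bisection, whence the factor 2 between [time_step]
    and the exact scaling. *)
Let pow_splits k : 2 `^ ((m * k)%:R * p) <= 2 ^+ splits k /\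
  2 ^+ splits k <= 2 * 2 `^ ((m * k)%:R * p) :> R.
Proof.
have /andP[c1 c2] := ceil_itv ((m * k)%:R * p : R).
have two0 : 2 != 0 :> R by [].
rewrite -powR_mulrn// splitsE; split; first by rewrite ler_powR ?ler1n.
rewrite -{2}[2]powRr1// -powRD ?two0 ?implybT//; apply: ler_powR; first by rewrite ler1n.
by move: c1; rewrite intrB; lra.
Qed.

Lemma time_step_le k : time_step k <= T * space_step k `^ p.
Proof.
rewrite /time_step powR_space_step mulrA ler_wpM2l//.
  by rewrite mulr_ge0 ?powR_ge0// ltW.
by rewrite ler_pV2 ?inE ?unitfE ?gt_eqF ?powR_gt0 ?exprn_gt0//; exact: (pow_splits k).1.
Qed.

Lemma time_step_ge k : T * space_step k `^ p <= 2 * time_step k.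
Proof.
have [_ h] := pow_splits k; rewrite /time_step powR_space_step.
rewrite mulrA [leRHS]mulrCA ler_wpM2l//; first by rewrite mulr_ge0 ?powR_ge0// ltW.
by rewrite ler_pdivlMr ?exprn_gt0// mulrC ler_pdivrMr ?powR_gt0.
Qed.

Lemma space_step0 : space_step 0 = L.
Proof. by rewrite /space_step muln0 expr0 divr1. Qed.

Lemma time_step0 : time_step 0 = T * L `^ p.
Proof.
by rewrite /time_step /splits muln0 mul0r Num.Theory.ceil0 absz0 expr0 divr1.
Qed.

Lemma powR_space_stepS k :
  space_step k `^ p = 2 `^ (m%:R * p) * space_step k.+1 `^ p.
Proof.
rewrite space_stepS powRM ?exprn_ge0//; last exact/ltW/space_step_gt0.
by rewrite -powR_mulrn// -powRrM.
Qed.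

Lemma powR_space_step_lt i j : (i < j)%N ->
  2 `^ (m%:R * p) * space_step j `^ p <= space_step i `^ p.
Proof.
move=> ij; rewrite (powR_space_stepS i) ler_wpM2l ?powR_ge0//.
apply: ge0_ler_powR; rewrite ?nnegrE; try exact/ltW/space_step_gt0.
  exact: p_ge0.
exact: (refines_small space_step_gt0 refines_space_step).
Qed.

Lemma space_step_small e : 0 < e -> exists k, space_step k < e.
Proof.
move=> e0; pose k := Num.Def.archi_bound (L / e).
exists k; rewrite ltr_pdivrMr ?exprn_gt0// [ltRHS]mulrC -ltr_pdivrMr//.
by apply: upper_nthrootP; rewrite leq_pmull.
Qed.

Lemma time_step_small e : 0 < e -> exists k, time_step k < e.
Proof.
move=> e0; pose k := Num.Def.archi_bound (T * L `^ p / e).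
exists k; rewrite ltr_pdivrMr ?exprn_gt0// [ltRHS]mulrC -ltr_pdivrMr//.
apply: upper_nthrootP; rewrite -(ler_nat R) splitsE.
have /andP[_ c2] := ceil_itv ((m * k)%:R * p : R).
apply: le_trans c2; apply: (@le_trans _ _ ((m * k)%:R * 1)).
  by rewrite mulr1 ler_nat leq_pmull.
by rewrite ler_wpM2l// ltW.
Qed.

End scales.

(** * Volumes and averages on the two parts of a parabolic rectangle *)

Section rectangles.
Context {R : realType} {n : nat}.
Variable p : R.
Local Notation mu := (lebesgue R n).
Implicit Types (S : parabolic_rectangle R n).

Lemma parabolic_rectangle_eq S1 S2 : rect_center S1 = rect_center S2 ->
  rect_time S1 = rect_time S2 -> rect_edge S1 = rect_edge S2 -> S1 = S2.
Proof.
case: S1 S2 => [x1 t1 l1 h1] [x2 t2 l2 h2] /= e1 e2 e3; subst.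
by rewrite (bool_irrelevance h1 h2).
Qed.

Lemma edge_powR_gt0 S : 0 < rect_edge S `^ p.
Proof. exact/powR_gt0/rect_edge_gt0. Qed.

Definition rect_volume S : R := rect_edge S ^+ n * rect_edge S `^ p.

Lemma rect_volume_gt0 S : 0 < rect_volume S.
Proof. by rewrite mulr_gt0 ?edge_powR_gt0// exprn_gt0// rect_edge_gt0. Qed.

Lemma lebesgue_rect_lower a S : a <= 1 ->
  mu (rect_lower p a S) = ((1 - a) * rect_volume S)%:E.
Proof.
move=> a1; have e0 := edge_powR_gt0 S.
rewrite lebesgue_box; first by congr (_%:E); rewrite /rect_volume; ring.
  exact/ltW/rect_edge_gt0.
have : a * rect_edge S `^ p <= 1 * rect_edge S `^ p by rewrite ler_wpM2r// ltW.
lra.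
Qed.

Lemma lebesgue_rect_upper a S : a <= 1 ->
  mu (rect_upper p a S) = ((1 - a) * rect_volume S)%:E.
Proof.
move=> a1; have e0 := edge_powR_gt0 S.
rewrite lebesgue_box; first by congr (_%:E); rewrite /rect_volume; ring.
  exact/ltW/rect_edge_gt0.
have : a * rect_edge S `^ p <= 1 * rect_edge S `^ p by rewrite ler_wpM2r// ltW.
lra.
Qed.

Lemma measurable_rect_lower a S : measurable (rect_lower p a S).
Proof. exact: measurable_box. Qed.

Lemma measurable_rect_upper a S : measurable (rect_upper p a S).
Proof. exact: measurable_box. Qed.

Variables (gamma N : R) (f : spacetime R n -> R).
Hypotheses (gamma_lt1 : gamma < 1) (f_loc : locally_integrable_spacetime f).

Lemma bmo_plus_excess S : (bmo_plus_norm p gamma f <= N%:E)%E ->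
  (\int[mu]_(z in rect_lower p gamma S) excess f (average (rect_upper p gamma S) f) z
   <= (N * ((1 - gamma) * rect_volume S))%:E)%E.
Proof.
move=> hN; set I := (\int[_]_(z in _) _)%E.
have V0 : 0 < (1 - gamma) * rect_volume S by rewrite mulr_gt0 ?rect_volume_gt0// subr_gt0.
have : ((((1 - gamma) * rect_volume S)^-1)%:E * I <= N%:E)%E.
  apply: le_trans hN; apply: ereal_sup_ubound; exists S => //.
  by rewrite /eaverage lebesgue_rect_lower// ltW.
by rewrite lee_pdivrMl// -EFinM mulrC.
Qed.

Lemma average_le_excess (a : R) S :
  (((average (rect_upper p gamma S) f - a) * ((1 - gamma) * rect_volume S))%:E
  <= \int[mu]_(z in rect_upper p gamma S) excess f a z)%E.
Proof.
have := @mean_excess _ _ _ mu f a (rect_upper p gamma S).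
rewrite lebesgue_rect_upper; last exact: ltW.
have V0 : 0 < (1 - gamma) * rect_volume S by rewrite mulr_gt0 ?rect_volume_gt0// subr_gt0.
rewrite -EFinM /average /eaverage lebesgue_rect_upper; last exact: ltW.
apply; [exact: measurable_rect_upper|by rewrite lte_fin|exact: ltry|].
exact: box_integrable.
Qed.

End rectangles.

(** * Position of cells relative to their rectangles *)

Section parabolic_grid.
Context {R : realType} {n : nat}.
Variables (p gamma alpha : R) (m : nat) (Q : parabolic_rectangle R n).
Hypotheses (p_gt1 : 1 < p) (gamma_gt0 : 0 < gamma).
Hypotheses (gamma_lt_alpha : gamma < alpha) (alpha_lt1 : alpha < 1).
Hypotheses (m_gt0 : (0 < m)%N) (m_large : 2 <= (alpha - gamma) * 2 `^ (m%:R * p)).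
Local Notation mu := (lebesgue R n).
Local Notation ST := (spacetime R n).

Let L := rect_edge Q.
Let L_gt0 : 0 < L := rect_edge_gt0 Q.
Let T_gt0 : 0 < 1 - alpha. Proof. by rewrite subr_gt0. Qed.

(** The lower corner of [Q] in space and, below, in time, so that the cell with zero indices is
    [R^-(alpha)]. *)
Definition grid_origin : 'rV[R]_n := \row_i (rect_center Q ord0 i - L / 2).
Definition grid_start : R := rect_time Q - L `^ p.

Local Notation l := (space_step L m).
Local Notation tau := (time_step p (1 - alpha) L m).

Definition grid_at := cell_at grid_origin grid_start l tau.
Definition grid_box := cell_box grid_origin grid_start l tau.

Let l_gt0 k : 0 < l k. Proof. exact: space_step_gt0. Qed.
Let tau_gt0 k : 0 < tau k. Proof. exact: time_step_gt0. Qed.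
Let lp_gt0 k : 0 < l k `^ p. Proof. exact: powR_gt0. Qed.
Let l_ref : refines l. Proof. exact: refines_space_step. Qed.
Let tau_ref : refines tau. Proof. exact: refines_time_step. Qed.

Lemma grid_boxP c z : grid_box c z <-> grid_at c.1 z = c.
Proof. exact: cell_boxP. Qed.

Lemma grid_at_box k z : grid_box (grid_at k z) z.
Proof. exact: cell_at_box. Qed.

Lemma grid_at_coarse k j z w : (k <= j)%N -> grid_at j z = grid_at j w ->
  grid_at k z = grid_at k w.
Proof. exact: cell_at_coarse. Qed.

Lemma grid_box_sub c c' z : (c'.1 <= c.1)%N -> grid_box c z -> grid_box c' z ->
  grid_box c `<=` grid_box c'.
Proof.
move=> cc /grid_boxP cz /grid_boxP c'z w /grid_boxP cw; apply/grid_boxP.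
by rewrite -c'z; apply: (@grid_at_coarse _ c.1) => //; rewrite cz cw.
Qed.

(** The time is chosen so that the rectangle starts together with the cell; the cell then lies in
    [S^-(alpha)]. *)
Definition grid_rect (c : cell n) : parabolic_rectangle R n :=
  ParabolicRectangle (cell_center grid_origin l c)
    (cell_start grid_start tau c + l c.1 `^ p) (l_gt0 c.1).

Definition root : cell n := (0%N, ([ffun=> 0], 0)).

Lemma grid_rect_root : grid_rect root = Q.
Proof.
apply: parabolic_rectangle_eq => /=.
- apply/rowP => i; rewrite !mxE/= ffunE space_step0 mul0r; lra.
- rewrite /cell_start /= space_step0 mul0r /grid_start; lra.
- exact: space_step0.
Qed.

Lemma rect_lower_grid a c : rect_lower p a (grid_rect c) =
  cube (cell_center grid_origin l c) (l c.1) `*`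
  `[cell_start grid_start tau c,
    cell_start grid_start tau c + (1 - a) * l c.1 `^ p[.
Proof.
by rewrite /rect_lower /=; congr (_ `*` `[_, _[%classic); apply/funext => _; ring.
Qed.

Lemma rect_upper_grid a c : rect_upper p a (grid_rect c) =
  cube (cell_center grid_origin l c) (l c.1) `*`
  `[cell_start grid_start tau c + (1 + a) * l c.1 `^ p,
    cell_start grid_start tau c + 2 * l c.1 `^ p[.
Proof.
by rewrite /rect_upper /=; congr (_ `*` `[_, _[%classic); apply/funext => _; ring.
Qed.

Lemma grid_box_root : grid_box root = rect_lower p alpha Q.
Proof.
by rewrite -grid_rect_root rect_lower_grid /grid_box /cell_box /= time_step0 space_step0.
Qed.

Lemma grid_box_rect c : grid_box c `<=` rect_lower p alpha (grid_rect c).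
Proof.
rewrite rect_lower_grid => z [h1 h2]; split=> //.
move: h2; rewrite /= !in_itv/= => /andP[-> h]; apply: lt_le_trans h _.
by rewrite lerD2l; exact: time_step_le.
Qed.

Lemma rect_lower_le a b S : a <= b ->
  rect_lower p b S `<=` (rect_lower p a S : set ST).
Proof.
move=> ab z [h1 h2]; split=> //.
move: h2; rewrite /= !in_itv/= => /andP[-> h]; apply: lt_le_trans h _.
by rewrite lerD2l lerN2 ler_wpM2r// powR_ge0.
Qed.

Lemma cube_center (x : 'rV[R]_n) (r : R) : 0 < r -> cube x r x.
Proof. by move=> r0 i; lra. Qed.

(** Points at the starting time of a cell serve to compare cells in space alone. *)
Lemma grid_box_base c y : cube (cell_center grid_origin l c) (l c.1) y ->
  grid_box c (y, cell_start grid_start tau c).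
Proof. by move=> cy; split=> //=; rewrite in_itv/= lexx/= ltrDl. Qed.

Lemma grid_box_nonempty c : grid_box c !=set0.
Proof. by eexists; exact/grid_box_base/cube_center. Qed.

(** Write [l] and [l'] for the edges of [c] and [c']. The cell [c] starts less than
    [(1 - alpha) l'^p] after [c'], and [S^+(gamma)] ends [2 l^p] after [c] starts. By [m_large] the
    latter is at most [(alpha - gamma) l'^p], which stays within the lower part for [gamma]. *)
Lemma rect_upper_sub_lower c c' : (c'.1 < c.1)%N -> grid_box c `<=` grid_box c' ->
  rect_upper p gamma (grid_rect c) `<=` rect_lower p gamma (grid_rect c').
Proof.
move=> cc sub; rewrite rect_upper_grid rect_lower_grid => z [zc zt].
have [h1 h2] := sub _ (grid_box_base zc).
split=> //; move: zt h2; rewrite /= !in_itv/=.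
move=> /andP[t1 t2] /andP[t3 t4].
have e1 := time_step_le m p_gt1 T_gt0 L_gt0 c'.1.
have e2 := powR_space_step_lt m p_gt1 L_gt0 cc.
have e3 := lp_gt0 c.1; have e4 := lp_gt0 c'.1.
have e5 : 2 * l c.1 `^ p <= (alpha - gamma) * l c'.1 `^ p.
  apply: (@le_trans _ _ ((alpha - gamma) * (2 `^ (m%:R * p) * l c.1 `^ p))).
    by rewrite mulrA ler_wpM2r// ltW.
  by rewrite ler_wpM2l// subr_ge0 ltW.
move: e1 e5; rewrite !mulrBl !mul1r => e1 e5.
have e6 : 0 <= (1 + gamma) * l c.1 `^ p by rewrite mulr_ge0 ?addr_ge0 // ltW.
by apply/andP; split; lra.
Qed.

(** A window of five time units [l^p], wide enough for every finer cell whose upper part meets that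
    of [c]; its length is the 5 in the Vitali constant. *)
Definition enlarged (c : cell n) : set ST :=
  cube (cell_center grid_origin l c) (l c.1) `*`
  `[cell_start grid_start tau c - 2 * l c.1 `^ p,
    cell_start grid_start tau c + 3 * l c.1 `^ p[.

Lemma lebesgue_enlarged c :
  mu (enlarged c) = (5 * rect_volume p (grid_rect c))%:E.
Proof.
rewrite /enlarged lebesgue_box; first by congr (_%:E); rewrite /rect_volume/=; ring.
  exact: ltW.
by have := lp_gt0 c.1; lra.
Qed.

Lemma grid_box_sub_enlarged c c' : (c.1 <= c'.1)%N ->
  rect_upper p gamma (grid_rect c) `&` rect_upper p gamma (grid_rect c') !=set0 ->
  grid_box c' `<=` enlarged c.
Proof.
move=> cc; rewrite !rect_upper_grid => -[[y t] [[yc tc] [yc' tc']]] w wc'.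
have lpc : l c'.1 `^ p <= l c.1 `^ p.
  apply: ge0_ler_powR; rewrite ?nnegrE; try exact: ltW.
    by apply: ltW; apply: lt_trans p_gt1.
  exact: (refines_small l_gt0 l_ref).
have e1 := time_step_le m p_gt1 T_gt0 L_gt0 c'.1.
have [wc1 wc2] := wc'.
(* The pair [(y, w.2)] takes its space from the common point and its time from [w]; it lies in [c'],
   hence in the coarse cell of [w]. *)
have yw : grid_at c.1 (y, w.2) = grid_at c.1 w.
  apply: (grid_at_coarse cc).
  move/grid_boxP : wc' => ->; apply/grid_boxP; by split.
have yc0 := iffLR (grid_boxP _ _) (grid_box_base yc).
split.
  have [+ _] := grid_at_box c.1 w; rewrite -yw.
  suff -> : cell_center grid_origin l (grid_at c.1 (y, w.2)) =
    cell_center grid_origin l c by [].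
  by rewrite -[in RHS]yc0.
move: tc tc' wc2; rewrite /= !in_itv/= => /andP[t1 t2] /andP[t3 t4] /andP[t5 t6].
have := lp_gt0 c.1; have := lp_gt0 c'.1 => lpc'0 lpc0.
have e2 : tau c'.1 <= l c'.1 `^ p.
  apply: le_trans e1 _; rewrite mulrBl mul1r gerBl mulr_ge0// ?ltW//.
  by apply: lt_trans gamma_lt_alpha.
have e3 : 0 < gamma * l c.1 `^ p by rewrite mulr_gt0.
have e4 : 0 < gamma * l c'.1 `^ p by rewrite mulr_gt0.
move: t1 t3; rewrite !mulrDl !mul1r => t1 t3.
by apply/andP; split; lra.
Qed.

Lemma lebesgue_grid_box c : mu (grid_box c) = (l c.1 ^+ n * tau c.1)%:E.
Proof. exact: lebesgue_cell_box. Qed.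

(** Rounding the duration loses at most a factor 2, so passing from [S^-(alpha)] to its cell at most
    doubles a density bound. *)
Lemma rect_volume_le_grid_box c :
  (((1 - alpha) * rect_volume p (grid_rect c))%:E <= 2%:E * mu (grid_box c))%E.
Proof.
rewrite lebesgue_grid_box -EFinM lee_fin /rect_volume/= mulrCA [leRHS]mulrCA.
by rewrite ler_wpM2l ?exprn_ge0 ?time_step_ge// ltW.
Qed.

Lemma rect_volume_parent c c' : c.1 = c'.1.+1 ->
  rect_volume p (grid_rect c') =
  ((2 ^+ m) ^+ n * 2 `^ (m%:R * p)) * rect_volume p (grid_rect c).
Proof.
move=> cc; rewrite /rect_volume /= cc (powR_space_stepS p m L_gt0 c'.1).
by rewrite [in LHS]space_stepS exprMn; ring.
Qed.

End parabolic_grid.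
(** * The good-lambda inequality *)

Section good_lambda.
Context {R : realType} {n : nat}.
Variables (p gamma alpha : R) (m : nat) (N : R) (f : spacetime R n -> R).
Hypotheses (p_gt1 : 1 < p) (gamma_gt0 : 0 < gamma).
Hypotheses (gamma_lt_alpha : gamma < alpha) (alpha_lt1 : alpha < 1).
Hypotheses (m_gt0 : (0 < m)%N) (m_large : 2 <= (alpha - gamma) * 2 `^ (m%:R * p)).
Hypotheses (N_gt0 : 0 < N) (f_loc : locally_integrable_spacetime f).
Hypothesis f_bmo : (bmo_plus_norm p gamma f <= N%:E)%E.
Local Notation mu := (lebesgue R n).
Local Notation ST := (spacetime R n).
Local Notation avg S := (average (rect_upper p gamma S) f).

Let T_gt0 : 0 < 1 - alpha. Proof. by rewrite subr_gt0. Qed.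
Let gamma_lt1 : gamma < 1. Proof. exact: lt_trans alpha_lt1. Qed.
Let G_gt0 : 0 < 1 - gamma. Proof. by rewrite subr_gt0. Qed.
Let mf : measurable_fun setT f. Proof. by case: f_loc. Qed.
Let alpha_le1 : alpha <= 1. Proof. exact: ltW. Qed.
Let gamma_le1 : gamma <= 1. Proof. exact: ltW. Qed.

(* In units of [N]: [stop_gap] turns the Vitali constant [5 / stop_gap] into
   [(1 - alpha) / 4], [parent_gap] is the ratio of the volumes of consecutive
   generations, and [tail_gap] makes the density of unstopped cells at most 1/4. *)
Definition stop_gap : R := 20 / (1 - alpha).
Definition parent_gap : R := (2 ^+ m) ^+ n * 2 `^ (m%:R * p).
Definition tail_gap : R := 8 / (1 - alpha).
Definition total_gap : R := stop_gap + parent_gap + tail_gap.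

Lemma stop_gap_gt0 : 0 < stop_gap. Proof. by rewrite divr_gt0. Qed.
Lemma tail_gap_gt0 : 0 < tail_gap. Proof. by rewrite divr_gt0. Qed.
Lemma parent_gap_gt0 : 0 < parent_gap.
Proof. by rewrite mulr_gt0 ?powR_gt0// !exprn_gt0. Qed.

Lemma measurable_superlevel (a : R) : measurable [set z : ST | a < f z].
Proof.
rewrite -[X in measurable X]setTI.
have mI : measurable [set x : R | a < x].
  rewrite (_ : [set _ | _] = `]a, +oo[%classic)//.
  by apply/seteqP; split=> x /=; rewrite in_itv/= andbT.
exact: mf measurableT _ mI.
Qed.

Lemma rect_upper_nonempty (S : parabolic_rectangle R n) :
  rect_upper p gamma S !=set0.
Proof.
exists (rect_center S, rect_time S + gamma * rect_edge S `^ p); split=> /=.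
  exact/cube_center/rect_edge_gt0.
by rewrite in_itv/= lexx/= ltrD2l gtr_pMl ?edge_powR_gt0.
Qed.

Variable Q : parabolic_rectangle R n.

Local Notation box := (grid_box p alpha m Q).
Local Notation at_ := (grid_at p alpha m Q).
Local Notation rect := (grid_rect p alpha m Q).
Local Notation X := (rect_lower p alpha Q).
Let a := avg Q.

Definition bad (c : cell n) : Prop := a + stop_gap * N < avg (rect c).

(** Maximality is tested against ancestors of positive level: the root has average [a] and is never
    bad. Positive level also puts the upper part of the rectangle inside [R^-(gamma)]. *)
Definition stopped : set (cell n) := [set c | [/\ (0 < c.1)%N, box c `<=` X, bad c &
  forall c', (0 < c'.1 < c.1)%N -> box c `<=` box c' -> ~ bad c']].

Lemma grid_box_sub_root c : box c `<=` X -> box c `<=` box root.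
Proof. by rewrite grid_box_root. Qed.

Lemma grid_at_sub_root k z : X z -> box (at_ k z) `<=` X.
Proof.
by rewrite -(grid_box_root p alpha m Q) => Xz; apply: grid_box_sub Xz => //; exact: grid_at_box.
Qed.

(** Take the least positive level at which the cell around [z] is bad. *)
Lemma bad_stopped k z : X z -> (0 < k)%N -> bad (at_ k z) ->
  exists2 c, stopped c & box c z.
Proof.
move=> Xz k0 kbad.
have ex : exists j, (0 < j)%N && `[<bad (at_ j z)>].
  by exists k; rewrite k0; exact/asboolP.
case: (ex_minnP ex) => j /andP[j0 /asboolP jbad] jmin.
exists (at_ j z); last exact: grid_at_box.
split=> //; first exact: grid_at_sub_root.
move=> c' /andP[c'0 c'j] sub c'bad.
have e : at_ c'.1 z = c' by apply/grid_boxP => //; apply: sub; exact: grid_at_box.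
have : (j <= c'.1)%N by apply: jmin; rewrite c'0 e; exact/asboolP.
by rewrite leqNgt c'j.
Qed.

(** If stopped cells of different levels met, the coarser would be a bad ancestor of the finer. *)
Lemma trivIset_stopped : trivIset stopped box.
Proof.
apply: trivIset_cell_box => [k|k|c1 c2 z]; [exact/space_step_gt0/rect_edge_gt0|
  exact/time_step_gt0/rect_edge_gt0|].
have key c c' : stopped c -> stopped c' -> box c z -> box c' z -> ~ (c.1 < c'.1)%N.
  move=> [c0 _ cbad _] [_ _ _ h] cz c'z cc; apply: (h c) => //; first by rewrite c0.
  by apply: grid_box_sub c'z cz => //; exact: ltnW.
move=> s1 s2 z1 z2; have h1 := key c1 c2 s1 s2 z1 z2.
have h2 := key c2 c1 s2 s1 z2 z1.
by case: (ltngtP c1.1 c2.1) h1 h2.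
Qed.

Lemma rect_upper_in_root c : (0 < c.1)%N -> box c `<=` X ->
  rect_upper p gamma (rect c) `<=` rect_lower p gamma Q.
Proof.
move=> c0 cX; rewrite -[Q in rect_lower _ _ Q](grid_rect_root p alpha m).
by apply: rect_upper_sub_lower => //; exact: grid_box_sub_root.
Qed.

(** Vitali selection on the upper parts, with [nu] the integral of the excess over [a]. Badness
    makes the mean excess at least [stop_gap * N] on each upper part, while the norm keeps it at
    most [N] on [R^-(gamma)]. *)
Lemma measure_stopped_le :
  (mu (\bigcup_(c in stopped) box c) <= (4^-1)%:E * mu X)%E.
Proof.
apply: measure_bigcup_le_finite; first by move=> c _; exact: measurable_cell_box.
move=> s hs.
pose nu (Y : set ST) := (\int[mu]_(z in Y) excess f a z)%E.
(* An enlarged cell has measure 5 times [rect_volume]; the excess on the upper part is at least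
   [stop_gap * N * (1 - gamma)] times [rect_volume]. *)
pose C := 5 / (stop_gap * N * (1 - gamma)).
have KN0 : 0 < stop_gap * N by rewrite mulr_gt0 ?stop_gap_gt0.
have C0 : 0 <= C by rewrite divr_ge0// ltW// mulr_gt0.
have := @vitali_finite _ _ _ _ mu nu (fun c => c.1)
  (fun c => rect_upper p gamma (rect c)) box (enlarged p alpha m Q) C stopped C0.
move=> /(_ _ _ _ _ (rect_lower p gamma Q) s) H.
apply: le_trans (H _ _ _ _ _ _) _.
- by move=> Y; apply: integral_ge0 => z _; exact: excess_ge0.
- by move=> Y Z mY mZ ZY; rewrite /nu integral_excess_setD.
- move=> c [c0 cX cbad _]; split.
  + exact: measurable_rect_upper.
  + exact: measurable_cell_box.
  + exact: measurable_box.
  + exact: rect_upper_nonempty.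
  + rewrite lebesgue_enlarged.
    apply: (@le_trans _ _ (C%:E *
        ((avg (rect c) - a) * ((1 - gamma) * rect_volume p (rect c)))%:E)%E);
      last first.
      by apply: lee_wpmul2l; [rewrite lee_fin|exact: average_le_excess].
    set V := rect_volume p _; have V0 : 0 < V := rect_volume_gt0 _ _.
    have -> : 5 * V = C * (stop_gap * N * ((1 - gamma) * V)).
      by rewrite /C; field; rewrite !gt_eqF ?stop_gap_gt0.
    rewrite -EFinM lee_fin; apply: ler_wpM2l => //; apply: ler_wpM2r.
      by rewrite mulr_ge0// ltW.
    by rewrite lerBrDl ltW.
- move=> c c' _ _ cc; exact: grid_box_sub_enlarged.
- exact: measurable_rect_lower.
- by move=> c /hs sc; split=> //; case: sc => c0 cX _ _; exact: rect_upper_in_root.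
apply: (@le_trans _ _ (C%:E * (N * ((1 - gamma) * rect_volume p Q))%:E)%E).
  by apply: lee_wpmul2l; [rewrite lee_fin|exact: bmo_plus_excess].
(* What remains is [5 / stop_gap = (1 - alpha) / 4]. *)
rewrite lebesgue_rect_lower// -!EFinM lee_fin /C /stop_gap.
rewrite le_eqVlt; apply/orP; left; apply/eqP; field.
by rewrite !gt_eqF.
Qed.

(** The parent is not bad, by maximality or because it is the root. Its lower part contains the
    upper part of [c], so the mean excess of [f] there over the average of the parent is at most [N]
    times the ratio of volumes. *)
Lemma stopped_average_le c : stopped c ->
  avg (rect c) <= a + (stop_gap + parent_gap) * N.
Proof.
move=> [c0 cX cbad hc].
have [z cz] := grid_box_nonempty p m Q alpha_lt1 c.
pose c' := at_ c.1.-1 z.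
have cc' : c.1 = c'.1.+1 by rewrite /= prednK.
have sub : box c `<=` box c'.
  by apply: (grid_box_sub p_gt1 alpha_lt1 _ cz); [rewrite cc'|exact: grid_at_box].
have c'le : avg (rect c') <= a + stop_gap * N.
  have [c'0|c'0] := posnP c'.1.
    have -> : c' = root.
      rewrite /c' -[c.1.-1]/(c'.1) c'0; apply/(@grid_boxP _ _ p alpha m Q _ root) => //.
      exact: grid_box_sub_root cX _ cz.
    rewrite grid_rect_root /a lerDl mulr_ge0// ?ltW// stop_gap_gt0//.
  rewrite leNgt; apply/negP; apply: hc => //; by rewrite c'0 cc'/=.
suff h : avg (rect c) - avg (rect c') <= parent_gap * N.
  rewrite mulrDl addrA; apply: le_trans (lerD c'le h).
  by rewrite [leRHS]addrC subrK.
have vc : 0 < (1 - gamma) * rect_volume p (rect c).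
  by rewrite mulr_gt0 ?rect_volume_gt0.
rewrite -(ler_pM2r vc) -lee_fin.
apply: (le_trans (average_le_excess _ gamma_lt1 f_loc _ _)).
apply: (@le_trans _ _ (\int[mu]_(z in rect_lower p gamma (rect c'))
    excess f (avg (rect c')) z)%E).
  apply: ge0_subset_integral.
  - exact: measurable_rect_upper.
  - exact: measurable_rect_lower.
  - exact: measurable_excess.
  - by move=> w _; exact: excess_ge0.
  - by apply: rect_upper_sub_lower => //; rewrite cc'.
apply: (le_trans (bmo_plus_excess gamma_lt1 _ f_bmo)).
rewrite lee_fin (rect_volume_parent p alpha m Q cc') -/parent_gap.
by rewrite le_eqVlt; apply/orP; left; apply/eqP; ring.
Qed.

Lemma unstopped_density h c : (h >= stop_gap + tail_gap) ->
  avg (rect c) <= a + stop_gap * N ->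
  (mu (box c `&` [set z | (a + h * N < f z)%R]) <= (4^-1)%:E * mu (box c))%E.
Proof.
move=> hh hc.
have M0 : 0 < tail_gap * N by rewrite mulr_gt0 ?tail_gap_gt0.
have mB : measurable (box c) by exact: measurable_cell_box.
have sub : box c `<=` rect_lower p gamma (rect c).
  move=> z /(grid_box_rect p_gt1 alpha_lt1); exact/rect_lower_le/ltW.
have := markov_excess mu (avg (rect c)) (measurable_rect_lower _ _ _) mB sub mf M0.
move=> /le_trans/(_ (bmo_plus_excess gamma_lt1 _ f_bmo)) H.
apply: (@le_trans _ _ (mu (box c `&` [set z | (avg (rect c) + tail_gap * N < f z)%R]))).
  apply: le_measure; rewrite ?inE.
  - by apply: measurableI => //; exact: measurable_superlevel.
  - by apply: measurableI => //; exact: measurable_superlevel.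
  move=> z [bz fz]; split=> //=; apply: le_lt_trans fz.
  have : (stop_gap + tail_gap) * N <= h * N by rewrite ler_wpM2r// ltW.
  lra.
set E := box c `&` _ in H *.
have mE : measurable E by apply: measurableI => //; exact: measurable_superlevel.
have Ele : (mu E <= mu (box c))%E by apply: le_measure; rewrite ?inE// => z [].
have := rect_volume_le_grid_box m Q p_gt1 alpha_lt1 c.
have Bfin : mu (box c) \is a fin_num by rewrite lebesgue_grid_box.
have Efin : mu E \is a fin_num.
  by rewrite ge0_fin_numE//; apply: le_lt_trans Ele _; rewrite ltey_eq Bfin.
move: H; rewrite -(fineK Bfin) -(fineK Efin) -!EFinM !lee_fin.
set e := fine (mu E); set b := fine _; set v := rect_volume _ _ => h1 h2.
have v0 : 0 < v := rect_volume_gt0 _ _.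
have {}h1 : tail_gap * e <= v.
  rewrite -(ler_pM2l N_gt0) mulrA [N * _]mulrC; apply: le_trans h1 _.
  by rewrite ler_pM2l// mulrBl mul1r gerBl mulr_ge0 ?ltW.
(* As [(1 - alpha) * tail_gap = 8], this reads [8 e <= 2 b]. *)
have : (1 - alpha) * (tail_gap * e) <= 2 * b.
  by apply: le_trans h2; rewrite ler_pM2l.
rewrite (_ : _ * (_ * e) = 8 * e); first lra.
by rewrite /tail_gap; field; rewrite gt_eqF.
Qed.

Lemma measurable_excess_set (h : R) :
  measurable (X `&` [set z : ST | a + h * N < f z]).
Proof. by apply: measurableI; [exact: measurable_box|exact: measurable_superlevel]. Qed.

Lemma measurable_stopped : measurable (\bigcup_(c in stopped) box c).
Proof. by apply: countable_bigcup_measurable => c _; exact: measurable_cell_box. Qed.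

Lemma unstopped_null (h : R) : total_gap <= h ->
  (mu ((X `&` [set z | (a + h * N < f z)%R]) `\` \bigcup_(c in stopped) box c) = 0)%E.
Proof.
move=> hh; set E := _ `\` _.
have mE : measurable E.
  by apply: measurableD; [exact: measurable_excess_set|exact: measurable_stopped].
(* The densities are tested from level 1 on, since only positive levels can be stopped; [X] is
   saturated there, being the root cell. *)
apply: (@null_of_low_density _ _ (grid_origin Q) (grid_start p Q)
  (space_step (rect_edge Q) m) (time_step p (1 - alpha) (rect_edge Q) m)
  _ _ _ _ _ _ X _ _ 1%N) => //.
- exact/space_step_gt0/rect_edge_gt0.
- exact/time_step_gt0/rect_edge_gt0.
- exact: refines_space_step.
- exact: refines_time_step.
- by move=> e; exact: space_step_small.
- by move=> e; exact: time_step_small.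
- exact: measurable_box.
- by rewrite lebesgue_rect_lower// ltry.
- rewrite -(grid_box_root p alpha m Q) => z w zw.
  move=> /(grid_boxP p m Q alpha_lt1) zr; apply/(grid_boxP p m Q alpha_lt1).
  by rewrite -zr; apply/esym; exact: grid_at_coarse zw.
- by move=> z [[]].
move=> k z k0 [[Xz _] nG].
have kle : avg (rect (at_ k z)) <= a + stop_gap * N.
  rewrite leNgt; apply/negP => kbad; apply: nG.
  by have [c sc cz] := bad_stopped Xz k0 kbad; exists c.
have mB : measurable (box (at_ k z)) by exact: measurable_cell_box.
have hh' : stop_gap + tail_gap <= h.
  apply: le_trans hh; rewrite /total_gap addrAC lerDl; exact/ltW/parent_gap_gt0.
apply: le_trans (unstopped_density hh' kle).
apply: le_measure; rewrite ?inE.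
- exact: measurableI.
- by apply: measurableI => //; exact: measurable_superlevel.
by move=> w [[[_ fw] _] bw]; split.
Qed.

(** Outside the stopped cells the superlevel set is null. In a stopped cell [H] applies to the
    rectangle of that cell, because [stopped_average_le] puts its level below the new one; hence [H]
    quantifies over all rectangles. *)
Lemma good_lambda (theta h : R) : 0 <= theta -> 0 <= h ->
  (forall S, (mu (rect_lower p alpha S `&` [set z | (avg S + h * N < f z)%R])
    <= theta%:E * mu (rect_lower p alpha S))%E) ->
  (mu (X `&` [set z | (a + (h + total_gap) * N < f z)%R])
    <= (theta / 2)%:E * mu X)%E.
Proof.
move=> th0 h0 H; set E := _ `&` _.
have mE : measurable E by exact: measurable_excess_set.
have E0 : mu (E `\` \bigcup_(c in stopped) box c) = 0%E.
  by apply: unstopped_null; rewrite lerDr.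
have -> : mu E = mu (E `&` \bigcup_(c in stopped) box c).
  apply: etrans (measureDI mu mE measurable_stopped) _.
  by apply: etrans (congr1 (fun x => x + _)%E E0) _; rewrite add0e.
(* Passing from [S^-(alpha)] to the cell doubles [theta]; the stopped cells fill at most a quarter
   of [X], which leaves [2 * theta / 4]. *)
apply: (@le_trans _ _ ((2 * theta)%:E * mu (\bigcup_(c in stopped) box c))%E).
  apply: le_measure_bigcup_density => //; first by rewrite mulr_ge0.
  - by move=> c _; exact: measurable_cell_box.
  - exact: trivIset_stopped.
  move=> c sc; have mB : measurable (box c) by exact: measurable_cell_box.
  apply: (@le_trans _ _ (theta%:E * mu (rect_lower p alpha (rect c)))%E); last first.
    rewrite lebesgue_rect_lower// [2 * _]mulrC (EFinM theta) -muleA.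
    by apply: lee_wpmul2l; [rewrite lee_fin|exact: rect_volume_le_grid_box].
  apply: le_trans (H (rect c)); apply: le_measure; rewrite ?inE.
  - exact: measurableI.
  - by apply: measurableI; [exact: measurable_box|exact: measurable_superlevel].
  move=> z [[_ fz] bz]; split; first exact: (grid_box_rect p_gt1 alpha_lt1).
  apply: le_lt_trans fz; have cle := stopped_average_le sc.
  apply: (le_trans (lerD cle (lexx _))).
  rewrite -addrA -mulrDl lerD2l ler_pM2r// addrC lerD2l /total_gap lerDl.
  exact/ltW/tail_gap_gt0.
apply: (@le_trans _ _ ((2 * theta)%:E * ((4^-1)%:E * mu X))%E).
  by apply: lee_wpmul2l; [rewrite lee_fin mulr_ge0|exact: measure_stopped_le].
rewrite muleA -EFinM le_eqVlt; apply/orP; left; apply/eqP; congr (_%:E * _)%E.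
by field.
Qed.

End good_lambda.

(** * Iteration of the good-lambda inequality *)

Section exponential_decay.
Context {R : realType} {n : nat}.
Variables (p gamma alpha : R).
Hypotheses (p_gt1 : 1 < p) (gamma_gt0 : 0 < gamma).
Hypotheses (gamma_lt_alpha : gamma < alpha) (alpha_lt1 : alpha < 1).
Local Notation mu := (lebesgue R n).
Local Notation ST := (spacetime R n).

(** As [p > 1], the power is at least [2 ^+ m], which is unbounded in [m]. *)
Lemma scale_exists : exists2 m : nat, (0 < m)%N &
  2 <= (alpha - gamma) * 2 `^ (m%:R * p).
Proof.
have d0 : 0 < alpha - gamma by rewrite subr_gt0.
pose m := (Num.Def.archi_bound (2 / (alpha - gamma))).+1; exists m => //.
rewrite mulrC -ler_pdivrMr//; apply: (@le_trans _ _ (2 ^+ m)).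
  by apply/ltW/upper_nthrootP; rewrite leqnSn.
rewrite -powR_mulrn//; apply: ler_powR; first by rewrite ler1n.
by rewrite ler_peMr// ltW.
Qed.

Lemma geometric_decay (m : nat) (N : R) (f : ST -> R) :
  (0 < m)%N -> 2 <= (alpha - gamma) * 2 `^ (m%:R * p) -> 0 < N ->
  locally_integrable_spacetime f -> (bmo_plus_norm p gamma f <= N%:E)%E ->
  forall (j : nat) (Q : parabolic_rectangle R n),
  (mu (rect_lower p alpha Q `&` [set z | (average (rect_upper p gamma Q) f +
      (j%:R * total_gap (n := n) p alpha m) * N < f z)%R])
    <= (2 ^- j)%:E * mu (rect_lower p alpha Q))%E.
Proof.
(* [Q] stays general in the induction: the next step uses the bound on the rectangles of all stopped
   cells. *)
move=> m0 hm N0 fl fN; elim=> [|j IH] Q.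
  rewrite expr0 invr1 mul1e; apply: le_measure; rewrite ?inE.
  - by apply: measurableI; [exact: measurable_box|apply: measurable_superlevel fl _].
  - exact: measurable_box.
  - by move=> z [].
rewrite exprSr invfM -natr1 mulrDl mul1r.
apply: (good_lambda p_gt1 gamma_gt0 gamma_lt_alpha alpha_lt1 m0 hm N0 fl fN Q _ _ IH).
  by rewrite invr_ge0 exprn_ge0.
apply: mulr_ge0 => //; apply: ltW; rewrite /total_gap.
by rewrite !addr_gt0 ?stop_gap_gt0 ?parent_gap_gt0 ?tail_gap_gt0.
Qed.

Lemma exponential_decay (m : nat) (N lambda : R) (f : ST -> R) (Q : parabolic_rectangle R n) :
  (0 < m)%N -> 2 <= (alpha - gamma) * 2 `^ (m%:R * p) -> 0 < N -> 0 < lambda ->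
  locally_integrable_spacetime f -> (bmo_plus_norm p gamma f <= N%:E)%E ->
  (mu (rect_lower p alpha Q `&`
      [set z | (lambda < f z - average (rect_upper p gamma Q) f)%R]) <=
    (2 * expR (- (ln 2 / total_gap (n := n) p alpha m * lambda) / N))%:E *
    mu (rect_lower p alpha Q))%E.
Proof.
move=> m0 hm N0 l0 fl fN; set K := total_gap _ _ _.
have K0 : 0 < K.
  by rewrite /K /total_gap !addr_gt0 ?stop_gap_gt0 ?parent_gap_gt0 ?tail_gap_gt0.
have x0 : 0 <= lambda / (K * N) by rewrite divr_ge0// ltW// mulr_gt0.
(* The number of whole steps of height [K * N] that fit into [lambda]. Rounding down loses at most
   one halving, whence the constant 2. *)
pose j := Num.truncn (lambda / (K * N)).
have /andP[j1 j2] := truncn_itv x0.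
apply: (@le_trans _ _ (mu (rect_lower p alpha Q `&`
    [set z | (average (rect_upper p gamma Q) f + (j%:R * K) * N < f z)%R]))).
  apply: le_measure; rewrite ?inE.
  - rewrite (_ : [set z | _] = [set z | average (rect_upper p gamma Q) f + lambda < f z]).
      by apply: measurableI; [exact: measurable_box|exact: measurable_superlevel].
    by apply/seteqP; split=> z /=; rewrite ltrBrDl.
  - by apply: measurableI; [exact: measurable_box|exact: measurable_superlevel].
  move=> z [Qz /= fz]; split=> //=; rewrite -ltrBrDl; apply: le_lt_trans fz.
  by rewrite -mulrA -ler_pdivlMr ?mulr_gt0.
apply: (le_trans (geometric_decay m0 hm N0 fl fN j Q)).
apply: lee_wpmul2r; first exact: measure_ge0.
have -> : - (ln 2 / K * lambda) / N = - (lambda / (K * N)) * ln 2.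
  by field; rewrite !gt_eqF.
rewrite lee_fin -[2 ^- j]mul1r ler_pdivrMr ?exprn_gt0// -mulrA -ler_pdivrMl// mulr1.
rewrite -powR_mulrn// /powR gt_eqF// -expRD -[X in X^-1]lnK ?posrE// -expRN ler_expR.
rewrite -mulN1r -mulrDl ler_wpM2r ?ln_ge0 ?ler1n//.
by move: j2; rewrite -natr1 -/j; set x := lambda / _; lra.
Qed.

End exponential_decay.

(** A consequence of [expR x >= 1 + x]; it makes the decay bound vanish as [N] tends to 0. *)
Lemma expRN_div_lt (R : realType) (t N : R) : 0 < t -> 0 < N -> expR (- t / N) <= N / t.
Proof.
move=> t0 N0; rewrite mulNr expRN -[leRHS]invrK lef_pV2 ?posrE ?expR_gt0 ?invr_gt0 ?divr_gt0//.
rewrite invf_div; apply: le_trans (expR_ge1Dx _); lra.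
Qed.

Theorem lemma3p1 (R : realType) (n : nat) (p gamma alpha : R)
    (p_gt1 : 1 < p) (gamma_gt0 : 0 < gamma) (gamma_lt_alpha : gamma < alpha)
    (alpha_lt1 : alpha < 1) :
  exists A B : R, 0 < A /\ 0 < B /\
    forall (f : spacetime R n -> R) (Q : parabolic_rectangle R n) (lambda : R),
      bmo_plus p gamma f -> 0 < lambda ->
      (lebesgue R n (rect_lower p alpha Q `&`
         [set z | (lambda < f z - average (rect_upper p gamma Q) f)%R]) <=
       (A * exp_decay (B * lambda) (bmo_plus_norm p gamma f))%:E *
         lebesgue R n (rect_lower p alpha Q))%E.
Proof.
have [m m0 hm] := scale_exists p_gt1 gamma_lt_alpha.
pose K := total_gap (n := n) p alpha m.
have K0 : 0 < K.
  by rewrite /K /total_gap !addr_gt0 ?stop_gap_gt0 ?parent_gap_gt0 ?tail_gap_gt0.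
have B0 : 0 < ln 2 / K by rewrite divr_gt0// ln_gt0// ltr1n.
(* [m], and with it [K], is fixed by [n], [p], [gamma] and [alpha] before [f] appears. *)
exists 2, (ln 2 / K); split=> //; split=> // f Q lambda [fl foo] l0.
have decay (N : R) (N0 : 0 < N) := exponential_decay p_gt1 gamma_gt0
  gamma_lt_alpha alpha_lt1 Q m0 hm N0 l0 fl.
have norm_ge0 : (0 <= bmo_plus_norm p gamma f)%E.
  apply: le_trans (ereal_sup_ubound _); last by exists Q.
  rewrite /eaverage; apply: mule_ge0; first by rewrite lee_fin invr_ge0 fine_ge0.
  by apply: integral_ge0 => z _; rewrite lee_fin le_max lexx orbT.
rewrite /exp_decay; case: eqP => [norm0|/eqP norm0].
  rewrite mulr0 mul0e.
  (* For zero norm every [N > 0] is an admissible bound, so the decay estimate holds with [N]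
     arbitrarily small. *)
  apply/lee_addgt0Pr => e e0; rewrite add0e.
  set t := ln 2 / K * lambda; set v := (1 - alpha) * rect_volume p Q.
  have t0 : 0 < t by rewrite mulr_gt0.
  have v0 : 0 < v by rewrite mulr_gt0 ?rect_volume_gt0// subr_gt0.
  (* Chosen so that [2 * (N / t) * v = e]. *)
  pose N := e * t / (2 * v).
  have N0 : 0 < N by rewrite /N divr_gt0 ?(mulr_gt0 e0) ?(mulr_gt0 _ v0).
  have fN : (bmo_plus_norm p gamma f <= N%:E)%E by rewrite norm0 lee_fin ltW.
  apply: (le_trans (decay N N0 fN)).
  rewrite lebesgue_rect_lower ?(ltW alpha_lt1)// -EFinM lee_fin.
  apply: (@le_trans _ _ (2 * (N / t) * v)).
    by rewrite ler_wpM2r ?(ltW v0)// ler_wpM2l// expRN_div_lt.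
  by rewrite le_eqVlt /N; apply/orP; left; apply/eqP; field; rewrite !gt_eqF.
have norm_fin : bmo_plus_norm p gamma f \is a fin_num by rewrite ge0_fin_numE.
apply: decay; last by rewrite fineK.
by rewrite fine_gt0// foo andbT lt_def norm0.
Qed.
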